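(* There is a Turing machine $M_{\mathsf{L}}$ that, given a closed term $s$ that has a normal form $t$, computes a heap $H$ and a closure $g$ such that $g\gg_H t$, in time $O(p(|s|,\mathrm{Time}(s)))$ for some polynomial $p$ and in space $O(\mathrm{Space}(s))$.
   Context: $\mathsf{L}$-terms (de Bruijn): $s::=n\mid st\mid\lambda s$, size $|n|=1+n$, $|\lambda s|=1+|s|$, $|st|=1+|s|+|t|$; closed means no free de Bruijn indices. Substitution $k^k_u=u$, $n^k_u=n$ ($n\ne k$), $(st)^k_u=(s^k_u)(t^k_u)$, $(\lambda s)^k_u=\lambda(s^{k+1}_u)$. Reduction: $(\lambda s)(\lambda t)\succ s^0_{\lambda t}$; $s\succ s'\Rightarrow st\succ s't$; $t\succ t'\Rightarrow(\lambda s)t\succ(\lambda s)t'$. If $s=s_0\succ\cdots\succ s_j=t$ with $t$ an abstraction (the normal form), $\mathrm{Time}(s)=j$ and $\mathrm{Space}(s)=\max_i|s_i|$. Programs are lists of commands $\mathsf{ret},\mathsf{var}\,n,\mathsf{lam},\mathsf{app}$; $\gamma n=[\mathsf{var}\,n]$, $\gamma(st)=\gamma s++\gamma t++[\mathsf{app}]$, $\gamma(\lambda s)=\mathsf{lam}::\gamma s++[\mathsf{ret}]$; terms are stored on tape as $\gamma s$ with unary indices. $P\gg s$ iff $P=\gamma u$ and $s=\lambda u$. A closure is a pair $(P,a)$ of a program and an address $a\in\mathbb N$; a heap entry is a pair $(g,b)$ of a closure and an address; a heap $H$ is a list of entries; $H[a]$ is the $a$-th entry for $1\le a\le|H|$,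 undefined otherwise. Lookup: if $H[a]=(g,b)$ then $H[a,0]=g$ and $H[a,n+1]=H[b,n]$; else undefined. Unfolding $\langle s,a\rangle\triangleright^H_k s'$: $\langle n,a\rangle\triangleright^H_k n$ if $n<k$; $\langle n,a\rangle\triangleright^H_k s'$ if $n\ge k$, $H[a,n-k]=(P,b)$, $P\gg u$, $\langle u,b\rangle\triangleright^H_0 s'$; $\langle\lambda s,a\rangle\triangleright^H_k\lambda s'$ if $\langle s,a\rangle\triangleright^H_{k+1}s'$; $\langle st,a\rangle\triangleright^H_k s't'$ if $\langle s,a\rangle\triangleright^H_k s'$ and $\langle t,a\rangle\triangleright^H_k t'$. $(P,a)\gg_H s$ iff $P\gg u$ and $\langle u,a\rangle\triangleright^H_0 s$ for some $u$. *)

(* Defs.v *)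
From mathcomp Require Import all_boot.
Set Implicit Arguments. Unset Strict Implicit. Unset Printing Implicit Defensive.

Inductive term : Type := tvar of nat | tapp of term & term | tlam of term.

Fixpoint lsize (s : term) : nat :=
  match s with
  | tvar n => n.+1
  | tapp s t => (lsize s + lsize t).+1
  | tlam s => (lsize s).+1
  end.

Fixpoint bound (k : nat) (s : term) : bool :=
  match s with
  | tvar n => n < k
  | tapp s t => bound k s && bound k t
  | tlam s => bound k.+1 s
  end.
Definition closedL (s : term) : bool := bound 0 s.

Fixpoint subst (s : term) (k : nat) (u : term) : term :=
  match s with
  | tvar n => if n == k then u else tvar n
  | tapp s t => tapp (subst s k u) (subst t k u)
  | tlam s => tlam (subst s k.+1 u)
  end.

Inductive step : term -> term -> Prop :=
| stepBeta s t : step (tapp (tlam s) (tlam t)) (subst s 0 (tlam t))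
| stepAppL s s' t : step s s' -> step (tapp s t) (tapp s' t)
| stepAppR s t t' : step t t' -> step (tapp (tlam s) t) (tapp (tlam s) t').

Definition is_abs (s : term) : bool := if s is tlam _ then true else false.

Fixpoint chain (s : term) (xs : seq term) : Prop :=
  match xs with
  | [::] => True
  | x :: xs' => step s x /\ chain x xs'
  end.

(* s = s_0 > ... > s_j = t with t an abstraction (the normal form) *)
Definition evaluates (s : term) (xs : seq term) (t : term) : Prop :=
  chain s xs /\ last s xs = t /\ is_abs t.

Definition Time (xs : seq term) : nat := size xs.
Definition Space (s : term) (xs : seq term) : nat := \max_(u <- s :: xs) lsize u.

Inductive cmd : Type := cRet | cVar of nat | cLam | cApp.

Fixpoint gamma (s : term) : seq cmd :=
  match s with
  | tvar n => [:: cVar n]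
  | tapp s t => gamma s ++ gamma t ++ [:: cApp]
  | tlam s => cLam :: gamma s ++ [:: cRet]
  end.

Definition prog_rep (P : seq cmd) (s : term) : Prop :=
  exists u, P = gamma u /\ s = tlam u.

Definition hclosure := (seq cmd * nat)%type.
Definition heap := seq (hclosure * nat).

(* H[a], 1-indexed *)
Definition heap_get (H : heap) (a : nat) : option (hclosure * nat) :=
  if 0 < a then onth H a.-1 else None.

Fixpoint lookup (H : heap) (a n : nat) : option hclosure :=
  match n with
  | 0 => omap fst (heap_get H a)
  | n'.+1 => match heap_get H a with
             | Some (_, b) => lookup H b n'
             | None => None
             end
  end.

Inductive unfolds (H : heap) : term -> nat -> nat -> term -> Prop :=
| unf_bound n a k : n < k -> unfolds H (tvar n) a k (tvar n)
| unf_free n a k P b u s' :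
    k <= n -> lookup H a (n - k) = Some (P, b) -> prog_rep P u ->
    unfolds H u b 0 s' -> unfolds H (tvar n) a k s'
| unf_lam s a k s' : unfolds H s a k.+1 s' -> unfolds H (tlam s) a k (tlam s')
| unf_app s t a k s' t' :
    unfolds H s a k s' -> unfolds H t a k t' -> unfolds H (tapp s t) a k (tapp s' t').

Definition closure_rep (H : heap) (g : hclosure) (s : term) : Prop :=
  exists u, prog_rep g.1 u /\ unfolds H u g.2 0 s.

Inductive sym : Type := sRet | sVar | sLam | sApp | sUn | sB0 | sB1 | sLpar | sRpar | sSep.

Definition enc_cmd (c : cmd) : seq sym :=
  match c with
  | cRet => [:: sRet]
  | cVar n => sVar :: nseq n sUn
  | cLam => [:: sLam]
  | cApp => [:: sApp]
  end.
Definition enc_prog (P : seq cmd) : seq sym := flatten (map enc_cmd P).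

(* addresses in binary, least significant bit first, no leading zeros *)
Fixpoint bits (fuel a : nat) : seq sym :=
  match fuel with
  | 0 => [::]
  | f.+1 => if a == 0 then [::] else (if odd a then sB1 else sB0) :: bits f a./2
  end.
Definition enc_addr (a : nat) : seq sym := bits a a.

Definition enc_clos (g : hclosure) : seq sym :=
  sLpar :: enc_prog g.1 ++ sSep :: enc_addr g.2 ++ [:: sRpar].
Definition enc_entry (e : hclosure * nat) : seq sym :=
  sLpar :: enc_clos e.1 ++ sSep :: enc_addr e.2 ++ [:: sRpar].
Definition enc_heap (H : heap) : seq sym := flatten (map enc_entry H).
Definition enc_output (H : heap) (g : hclosure) : seq sym :=
  enc_heap H ++ sSep :: enc_clos g.

(* cells: None = blank.  A tape (ls, m, rs): ls = cells left of head (nearest first),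
   m = cell under head, rs = cells right of head. Only visited cells are stored. *)
Definition tape (Sig : Type) := (seq (option Sig) * option Sig * seq (option Sig))%type.

Inductive move : Type := Lmove | Nmove | Rmove.

Definition tape_move (Sig : Type) (t : tape Sig) (d : move) : tape Sig :=
  let: (ls, m, rs) := t in
  match d with
  | Nmove => t
  | Rmove => match rs with [::] => (m :: ls, None, [::]) | x :: rs' => (m :: ls, x, rs') end
  | Lmove => match ls with [::] => ([::], None, m :: rs) | x :: ls' => (ls', x, m :: rs) end
  end.

Definition tape_write (Sig : Type) (t : tape Sig) (w : option Sig) : tape Sig :=
  let: (ls, _, rs) := t in (ls, w, rs).

Definition tape_current (Sig : Type) (t : tape Sig) : option Sig := let: (_, m, _) := t in m.

Definition tape_len (Sig : Type) (t : tape Sig) : nat :=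
  let: (ls, _, rs) := t in (size ls + size rs).+1.

Definition tape_content (Sig : Type) (t : tape Sig) : seq (option Sig) :=
  let: (ls, m, rs) := t in rev ls ++ m :: rs.

Definition tape_holds (Sig : Type) (t : tape Sig) (w : seq Sig) : Prop :=
  exists i j, tape_content t = nseq i None ++ map Some w ++ nseq j None.

Definition input_tape (Sig : Type) (w : seq Sig) : tape Sig :=
  match map Some w with
  | [::] => ([::], None, [::])
  | x :: xs => ([::], x, xs)
  end.

Definition empty_tape (Sig : Type) : tape Sig := ([::], None, [::]).

Record TM (Sig : finType) (n : nat) := {
  tm_state : finType;
  tm_start : tm_state;
  tm_halt : tm_state -> bool;
  tm_trans : tm_state -> {ffun 'I_n -> option Sig} ->
             tm_state * {ffun 'I_n -> option Sig * move}
}.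

Definition config (Sig : finType) (n : nat) (M : TM Sig n) :=
  (tm_state M * ('I_n -> tape Sig))%type.

Definition tm_step (Sig : finType) (n : nat) (M : TM Sig n) (c : config M) : config M :=
  let: (q, ts) := c in
  if @tm_halt Sig n M q then c else
  let: (q', acts) := @tm_trans Sig n M q [ffun i => tape_current (ts i)] in
  (q', fun i => tape_move (tape_write (ts i) (acts i).1) (acts i).2).

Definition tm_run (Sig : finType) (n : nat) (M : TM Sig n) (k : nat) (c : config M) : config M :=
  iter k (@tm_step Sig n M) c.

Definition tm_init (Sig : finType) (n : nat) (M : TM Sig n.+1) (w : seq Sig) : config M :=
  (@tm_start Sig n.+1 M, fun i : 'I_n.+1 => if i == ord0 then input_tape w else @empty_tape Sig).

Definition tm_halted (Sig : finType) (n : nat) (M : TM Sig n) (c : config M) : bool :=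
  @tm_halt Sig n M c.1.

Definition tm_space (Sig : finType) (n : nat) (M : TM Sig n) (c : config M) : nat :=
  \sum_(i < n) tape_len (c.2 i).

(* Main.v *)
(* Two machines for the weak call-by-value lambda-calculus run on the same term, and at each
   turn the one whose current state is smaller makes a step. The first rewrites terms by
   substitution: its state has the size of the current term, hence never exceeds twice
   [Space s], but may become exponentially large in [Time s]. The second keeps closures and a
   shared heap: its state has size polynomial in [lsize s] and [Time s], but possibly larger
   than [Space s]. Since one step at most doubles the heap state (up to a constant), the heap
   machine only moves within space O(Space s); and since one step at most squares the size of a
   term, the substitution machine only reaches states of polynomial size. Both machines need
   O(Time s) steps, so the first one to halt does so within both bounds, without any step
   counter or space budget having to be maintained. At the end the heap addresses, unary
   during the computation, are converted to binary.

   The Turing machine is compiled from a program over finitely many stacks, one per tape;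
   procedures are called by renaming stacks. A run of time K needs space at most K more than
   its initial state, so explicit space bounds are tracked only for superlinear loops. *)
From HB Require Import structures.
Require Import Defs.
From Stdlib Require List.
From mathcomp Require Import all_boot zify.
Set Implicit Arguments. Unset Strict Implicit. Unset Printing Implicit Defensive.

(** Sizes are compared as encoded on the stacks, unary addresses and separators included, so a bound
    for the smaller machine is at once a bound for the tapes. The heap machine is not related to
    reduction directly: the invariant carries a ghost state of the substitution machine which
    advances along with the heap machine, while the actual substitution machine runs at its own
    pace. Both follow the given reduction sequence, at different positions, and reduction is
    deterministic, so whichever machine halts first holds the normal form. The ghost also bounds the
    heap machine: entries correspond to contractions, hence number at most [Time xs], and the two
    value stacks have equal length. The joint state thus has two independent size bounds, a
    polynomial one used for time and a linear one used for space, which are kept apart to the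
    end. *)

Definition sym_bits (x : sym) : bool * bool * bool * bool :=
  match x with
  | sRet => (false, false, false, false) | sVar => (false, false, false, true)
  | sLam => (false, false, true, false) | sApp => (false, false, true, true)
  | sUn => (false, true, false, false) | sB0 => (false, true, false, true)
  | sB1 => (false, true, true, false) | sLpar => (false, true, true, true)
  | sRpar => (true, false, false, false) | sSep => (true, false, false, true)
  end.
Definition bits_sym (b : bool * bool * bool * bool) : option sym :=
  match b with
  | (false, false, false, false) => Some sRet | (false, false, false, true) => Some sVar
  | (false, false, true, false) => Some sLam | (false, false, true, true) => Some sApp
  | (false, true, false, false) => Some sUn | (false, true, false, true) => Some sB0
  | (false, true, true, false) => Some sB1 | (false, true, true, true) => Some sLpar
  | (true, false, false, false) => Some sRpar | (true, false, false, true) => Some sSep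
  | _ => None
  end.
Lemma sym_bitsK : pcancel sym_bits bits_sym. Proof. by case. Qed.
HB.instance Definition _ := Finite.copy sym (pcan_type sym_bitsK).

(** * Stack programs *)

Definition state := seq (seq sym).

Definition get (S : state) (i : nat) : seq sym := nth [::] S i.
Fixpoint upd (S : state) (i : nat) (v : seq sym) : state :=
  match S, i with
  | [::], _ => [::]
  | _ :: S', 0 => v :: S'
  | x :: S', i'.+1 => x :: upd S' i' v
  end.
Definition top (S : state) (i : nat) : option sym := ohead (get S i).
Fixpoint tot (S : state) : nat := if S is x :: S' then size x + tot S' else 0.

(* [Op i b j f]: read the top [o] of stack [i], pop it when [b] holds, then push
   [f o] on stack [j], unless [f o] is [None]. *)
Inductive prog : Type :=
| Op of nat & bool & nat & (option sym -> option sym)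
| Seq of prog & prog
| If of nat & (option sym -> bool) & prog & prog
| While of nat & (option sym -> bool) & prog.

Definition op i (b : bool) j (f : option sym -> option sym) (S : state) : state :=
  let S1 := if b then upd S i (behead (get S i)) else S in
  if f (top S i) is Some x then upd S1 j (x :: get S1 j) else S1.

(** [B] bounds the total stack height of every state visited. It is checked only at [Op] and at loop
    exit, since every other state is also the initial state of a subprogram. *)
Inductive exec (B : nat) : prog -> state -> nat -> state -> Prop :=
| ExOp i b j f S : tot S <= B -> tot (op i b j f S) <= B ->
    exec B (Op i b j f) S 1 (op i b j f S)
| ExSeq p q S k1 S1 k2 S2 : exec B p S k1 S1 -> exec B q S1 k2 S2 ->
    exec B (Seq p q) S (k1 + k2) S2
| ExIfT i (f : option sym -> bool) p q S k S' : f (top S i) -> exec B p S k S' ->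
    exec B (If i f p q) S k.+1 S'
| ExIfF i (f : option sym -> bool) p q S k S' : ~~ f (top S i) -> exec B q S k S' ->
    exec B (If i f p q) S k.+1 S'
| ExWhF i (f : option sym -> bool) p S : ~~ f (top S i) -> tot S <= B ->
    exec B (While i f p) S 1 S
| ExWhT i (f : option sym -> bool) p S k1 S1 k2 S2 : f (top S i) ->
    exec B p S k1 S1 -> exec B (While i f p) S1 k2 S2 ->
    exec B (While i f p) S (k1 + k2).+1 S2.

Lemma exec_weak B B' p S k S' : B <= B' -> exec B p S k S' -> exec B' p S k S'.
Proof.
move=> leB; elim=> {p S k S'}.
- by move=> *; apply: ExOp; apply: leq_trans leB.
- by move=> *; apply: ExSeq; eassumption.
- by move=> *; apply: ExIfT.
- by move=> *; apply: ExIfF.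
- by move=> *; apply: ExWhF => //; apply: leq_trans leB.
- by move=> *; apply: ExWhT; eassumption.
Qed.

Lemma size_upd S i v : size (upd S i v) = size S.
Proof. by elim: S i => [|x S IH] [|i] //=; rewrite IH. Qed.

Lemma tot_upd_le S i v : tot (upd S i v) <= tot S + size v.
Proof. by elim: S i => [|x S IH] [|i] //=; [lia | have := IH i; lia]. Qed.

Lemma tot_push S i x : tot (upd S i (x :: get S i)) <= (tot S).+1.
Proof. by elim: S i => [|y S IH] [|i] //=; have := IH i; rewrite /get /=; lia. Qed.

Lemma tot_pop S i : tot (upd S i (behead (get S i))) <= tot S.
Proof.
by elim: S i => [|y S IH] [|i] //=; [rewrite size_behead; lia | have := IH i; rewrite /get /=; lia].
Qed.

Lemma tot_op i b j f S : tot (op i b j f S) <= (tot S).+1.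
Proof.
rewrite /op; set S1 := if b then _ else _.
have h1 : tot S1 <= tot S by rewrite /S1; case: (b) => //; apply: tot_pop.
by case: (f _) => [x|]; [have := tot_push S1 j x; lia | lia].
Qed.

(** A unit of time pushes at most one symbol, so the height grows by at most the time spent.
    Whatever space bound a run was derived with can therefore be replaced by [tot S + k]. *)
Lemma exec_lin B p S k S' : exec B p S k S' -> tot S' <= tot S + k /\ exec (tot S + k) p S k S'.
Proof.
elim=> {p S k S'}.
- move=> i b j f S _ _; have h := tot_op i b j f S.
  by split; [lia | apply: ExOp; lia].
- move=> p q S k1 S1 k2 S2 _ [h1 e1] _ [h2 e2]; split; first lia.
  apply: ExSeq; [apply: exec_weak e1 | apply: exec_weak e2]; lia.
- move=> i f p q S k S' hf _ [h1 e1]; split; first lia.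
  apply: ExIfT => //; apply: exec_weak e1; lia.
- move=> i f p q S k S' hf _ [h1 e1]; split; first lia.
  apply: ExIfF => //; apply: exec_weak e1; lia.
- by move=> i f p S hf _; split; [lia | apply: ExWhF => //; lia].
- move=> i f p S k1 S1 k2 S2 hf _ [h1 e1] _ [h2 e2]; split; first lia.
  apply: ExWhT => //; [apply: exec_weak e1 | apply: exec_weak e2]; lia.
Qed.

Lemma exec_tot B p S k S' : exec B p S k S' -> tot S <= B /\ tot S' <= B.
Proof. by elim=> {p S k S'} //; intuition. Qed.

(** * Runs with time and space bounds *)

Definition runs (p : prog) (S S' : state) (K B : nat) : Prop :=
  exists2 k, k <= K & exec B p S k S'.

(** The space component is the one that [exec_lin] gives for free, so linear-time procedures are
    specified by their time alone. *)
Definition runT (p : prog) (S S' : state) (K : nat) : Prop :=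
  runs p S S' K (tot S + K).

Lemma runs_weak p S S' K B K' B' : runs p S S' K B -> K <= K' -> B <= B' -> runs p S S' K' B'.
Proof.
by case=> k hk e hK hB; exists k; [apply: leq_trans hK | apply: exec_weak e].
Qed.

Lemma runs_T p S S' K B : runs p S S' K B -> runT p S S' K.
Proof.
by case=> k hk /exec_lin[_ e]; exists k => //; apply: exec_weak e; rewrite leq_add2l.
Qed.

Lemma runT_runs p S S' K K' B : runT p S S' K -> K <= K' -> tot S + K <= B -> runs p S S' K' B.
Proof. by move=> h hK hB; apply: runs_weak h _ _. Qed.

Lemma runT_le p S S' K K' : runT p S S' K -> K <= K' -> runT p S S' K'.
Proof. by move=> h hK; apply: (runs_T (B := tot S + K)); apply: runs_weak h _ _. Qed.

Lemma runs_seq p q S S1 S2 K1 K2 B :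
  runs p S S1 K1 B -> runs q S1 S2 K2 B -> runs (Seq p q) S S2 (K1 + K2) B.
Proof.
move=> [k1 h1 e1] [k2 h2 e2]; exists (k1 + k2); first exact: leq_add.
by apply: ExSeq e2.
Qed.

Lemma runs_tot p S S' K B : runs p S S' K B -> tot S <= B /\ tot S' <= B.
Proof. by case=> k _ /exec_tot. Qed.

Lemma runT_tot p S S' K : runT p S S' K -> tot S' <= tot S + K.
Proof. by case/runs_tot. Qed.

Lemma runT_seq p q S S1 S2 K1 K2 :
  runT p S S1 K1 -> runT q S1 S2 K2 -> runT (Seq p q) S S2 (K1 + K2).
Proof.
move=> r1 r2; have h := runT_tot r1; rewrite /runT addnA.
apply: runs_seq (runs_weak r1 _ _) (runs_weak r2 _ _) => //; lia.
Qed.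

Lemma runT_op i b j f S : runT (Op i b j f) S (op i b j f S) 1.
Proof. by exists 1 => //; apply: ExOp; rewrite addn1 // tot_op. Qed.

Lemma runT_opseq i b j f q S S' K :
  runT q (op i b j f S) S' K -> runT (Seq (Op i b j f) q) S S' (1 + K).
Proof. exact/runT_seq/runT_op. Qed.

Lemma runs_ifT i (f : option sym -> bool) p q S S' K B :
  f (top S i) -> runs p S S' K B -> runs (If i f p q) S S' (1 + K) B.
Proof. by move=> hf [k hk e]; exists k.+1 => //; apply: ExIfT. Qed.

Lemma runs_ifF i (f : option sym -> bool) p q S S' K B :
  ~~ f (top S i) -> runs q S S' K B -> runs (If i f p q) S S' (1 + K) B.
Proof. by move=> hf [k hk e]; exists k.+1 => //; apply: ExIfF. Qed.

Lemma runT_ifT i (f : option sym -> bool) p q S S' K :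
  f (top S i) -> runT p S S' K -> runT (If i f p q) S S' (1 + K).
Proof. by move=> hf h; apply: runs_T; apply: runs_ifT h. Qed.

Lemma runT_ifF i (f : option sym -> bool) p q S S' K :
  ~~ f (top S i) -> runT q S S' K -> runT (If i f p q) S S' (1 + K).
Proof. by move=> hf h; apply: runs_T; apply: runs_ifF h. Qed.

Lemma runs_whF i (f : option sym -> bool) p S B :
  ~~ f (top S i) -> tot S <= B -> runs (While i f p) S S 1 B.
Proof. by move=> hf hB; exists 1 => //; apply: ExWhF. Qed.

Lemma runT_whF i (f : option sym -> bool) p S : ~~ f (top S i) -> runT (While i f p) S S 1.
Proof. by move=> hf; apply: runs_whF => //; lia. Qed.

Lemma runs_whT i (f : option sym -> bool) p S S1 S2 K1 K2 B :
  f (top S i) -> runs p S S1 K1 B -> runs (While i f p) S1 S2 K2 B ->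
  runs (While i f p) S S2 (K1 + K2).+1 B.
Proof.
move=> hf [k1 h1 e1] [k2 h2 e2]; exists (k1 + k2).+1; first by rewrite ltnS leq_add.
by apply: ExWhT e2.
Qed.

Lemma runT_whT i (f : option sym -> bool) p S S1 S2 K1 K2 :
  f (top S i) -> runT p S S1 K1 -> runT (While i f p) S1 S2 K2 ->
  runT (While i f p) S S2 (K1 + K2).+1.
Proof.
move=> hf r1 r2; have h := runT_tot r1.
apply: (runs_T (B := tot S + K1 + K2)).
by apply: runs_whT hf (runs_weak r1 _ _) (runs_weak r2 _ _) => //; lia.
Qed.

(** * Procedure calls: renaming of the stacks *)

(* 99 stands for an index beyond every stack in use. *)
Definition idx (r : seq nat) (i : nat) : nat := nth 99 r i.

Fixpoint ren (r : seq nat) (p : prog) : prog :=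
  match p with
  | Op i b j f => Op (idx r i) b (idx r j) f
  | Seq p q => Seq (ren r p) (ren r q)
  | If i f p q => If (idx r i) f (ren r p) (ren r q)
  | While i f p => While (idx r i) f (ren r p)
  end.

Fixpoint embed (G : state) (r : seq nat) (S : state) : state :=
  match r, S with
  | i :: r', v :: S' => upd (embed G r' S') i v
  | _, _ => G
  end.

(** [size G <= 99] puts the default index of [idx] outside [G]: an access of the procedure beyond
    its own stacks reads empty and writes nothing, before and after renaming. *)
Definition fits (G : state) (r : seq nat) : bool :=
  [&& uniq r, all (fun i => i < size G) r & size G <= 99].

Lemma size_embed G r S : size (embed G r S) = size G.
Proof. by elim: r S => [|i r IH] [|v S] //=; rewrite size_upd. Qed.

Lemma get_upd G i j v : get (upd G i v) j = if (i == j) && (i < size G) then v else get G j.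
Proof. by elim: G i j => [|x G IH] [|i] [|j] //=; rewrite ?andbF // /get /= -/(get _ _) IH. Qed.

Lemma upd_comm G i j v w : i != j -> upd (upd G i v) j w = upd (upd G j w) i v.
Proof. by elim: G i j => [|x G IH] [|i] [|j] //= ij; rewrite IH. Qed.

Lemma upd_twice G i v w : upd (upd G i v) i w = upd G i w.
Proof. by elim: G i => [|x G IH] [|i] //=; rewrite IH. Qed.

Lemma upd_get G i : upd G i (get G i) = G.
Proof. by elim: G i => [|x G IH] [|i] //=; rewrite /get /= -/(get _ _) IH. Qed.

Lemma upd_out G i v : size G <= i -> upd G i v = G.
Proof. by elim: G i => [|x G IH] [|i] //= hi; rewrite IH. Qed.

Lemma get_embed G r S i : fits G r -> size S = size r -> get (embed G r S) (idx r i) = get S i.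
Proof.
case/and3P; elim: r S i => [|j r IH] [|v S] i //=.
  by move=> _ _ h _; rewrite /idx /get nth_nil !nth_default // nth_nil.
case/andP=> jr ur /andP[jG rG] hG [hS]; case: i => [|i].
  by rewrite /idx /= get_upd eqxx size_embed jG.
rewrite /idx /= -/(idx r i) get_upd size_embed jG andbT.
case: eqP => [e|_]; last by rewrite IH.
case: (ltnP i (size r)) => hi; first by case/negP: jr; rewrite e mem_nth.
by move: e jG; rewrite /idx nth_default // => ->; rewrite ltnNge hG.
Qed.

Lemma upd_embed G r S i v : fits G r -> size S = size r ->
  upd (embed G r S) (idx r i) v = embed G r (upd S i v).
Proof.
case/and3P; elim: r S i => [|j r IH] [|w S] i //=.
  by move=> _ _ h _; rewrite upd_out // /idx nth_nil.
case/andP=> jr ur /andP[jG rG] hG [hS]; case: i => [|i].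
  by rewrite /idx /= upd_twice.
rewrite /idx /= -/(idx r i) -IH //.
case: (ltnP i (size r)) => hi.
  by rewrite upd_comm //; apply: contraNneq jr => ->; rewrite mem_nth.
by rewrite /idx nth_default // !(@upd_out _ 99) // ?size_upd ?size_embed.
Qed.

Lemma tot_embed G r S : tot (embed G r S) <= tot G + tot S.
Proof.
elim: r S => [|i r IH] [|v S] /=; try lia.
by have := tot_upd_le (embed G r S) i v; have := IH S; lia.
Qed.

Lemma op_embed G r S i b j f : fits G r -> size S = size r ->
  op (idx r i) b (idx r j) f (embed G r S) = embed G r (op i b j f S).
Proof.
move=> hf hS; rewrite /op /top get_embed //.
set S1 := if b then _ else _; set S2 := if b then upd S i _ else S.
have -> : S1 = embed G r S2 by rewrite /S1 /S2; case: (b); rewrite ?get_embed ?upd_embed.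
have hS2 : size S2 = size r by rewrite /S2; case: (b); rewrite ?size_upd.
by case: (f _) => // x; rewrite get_embed // upd_embed.
Qed.

Lemma size_op i b j f S : size (op i b j f S) = size S.
Proof. by rewrite /op; case: (f _) => [x|]; case: b; rewrite ?size_upd. Qed.

Lemma exec_size B p S k S' : exec B p S k S' -> size S' = size S.
Proof. by elim=> {p S k S'} // => [*|*|*]; rewrite ?size_op //; congruence. Qed.

Lemma exec_ren G r B p S k S' : exec B p S k S' -> fits G r -> size S = size r ->
  exec (tot G + B) (ren r p) (embed G r S) k (embed G r S').
Proof.
move=> e hG; elim: e => {p S k S'} /=.
- move=> i b j f S h1 h2 hS; rewrite -op_embed //; apply: ExOp; rewrite ?op_embed //.
    by have := tot_embed G r S; lia.
  by have := tot_embed G r (op i b j f S); lia.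
- move=> p q S k1 S1 k2 S2 e1 IH1 e2 IH2 hS; apply: ExSeq; first exact: IH1.
  by apply: IH2; rewrite (exec_size e1).
- by move=> i f p q S k S' hf e IH hS; apply: ExIfT; rewrite ?/top ?get_embed //; apply: IH.
- by move=> i f p q S k S' hf e IH hS; apply: ExIfF; rewrite ?/top ?get_embed //; apply: IH.
- move=> i f p S hf hB hS; apply: ExWhF; rewrite ?/top ?get_embed //.
  by have := tot_embed G r S; lia.
- move=> i f p S k1 S1 k2 S2 hf e1 IH1 e2 IH2 hS.
  by apply: ExWhT; rewrite ?/top ?get_embed //; [apply: IH1 | apply: IH2; rewrite (exec_size e1)].
Qed.

Lemma embed_get G r : embed G r (map (get G) r) = G.
Proof. by elim: r => [|i r IH] //=; rewrite IH upd_get. Qed.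

Lemma runs_call r p G S' K B : fits G r -> runs p (map (get G) r) S' K B ->
  runs (ren r p) G (embed G r S') K (tot G + B).
Proof.
move=> hG [k hk e]; exists k => //.
by have := exec_ren e hG; rewrite embed_get; apply; rewrite size_map.
Qed.

Lemma runT_call r p G S' K : fits G r -> runT p (map (get G) r) S' K ->
  runT (ren r p) G (embed G r S') K.
Proof. by move=> hG h; apply: runs_T; apply: runs_call h. Qed.

Lemma runT_callseq r p q G S1 S2 K1 K2 : fits G r -> runT p (map (get G) r) S1 K1 ->
  runT q (embed G r S1) S2 K2 -> runT (Seq (ren r p) q) G S2 (K1 + K2).
Proof. by move=> hG h; apply: runT_seq; apply: runT_call. Qed.

(** * Compilation to Turing machines *)

Section Compile.
Variable n : nat.

Local Notation view := {ffun 'I_n.+1 -> option sym}.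
Local Notation acts := {ffun 'I_n.+1 -> option sym * move}.

Definition vget (v : view) (i : nat) : option sym := if insub i is Some k then v k else None.
Definition act1 (v : view) (i : nat) (w : option sym) (d : move) : acts :=
  [ffun k => if val k == i then (w, d) else (v k, Nmove)].
Definition act0 (v : view) : acts := [ffun k => (v k, Nmove)].

(** Control states follow the syntax; [If] and [While] add a state for the test. For [Op],
    [Some (b, x)] remembers the symbol [x] to be pushed, and [b] whether the head has already moved
    to the new cell. *)
Fixpoint ctrl (p : prog) : finType :=
  match p with
  | Op _ _ _ _ => option (bool * sym) : finType
  | Seq p q => (ctrl p + ctrl q)%type : finType
  | If _ _ p q => option (ctrl p + ctrl q) : finType
  | While _ _ p => option (ctrl p) : finType
  end.

Fixpoint ctrl0 (p : prog) : ctrl p :=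
  match p with
  | Op _ _ _ _ => None
  | Seq p q => inl (ctrl0 p)
  | If _ _ p q => None
  | While _ _ p => None
  end.

Definition tr_op i (b : bool) j (f : option sym -> option sym) (q : option (bool * sym)) (v : view) :
    option (option (bool * sym)) * acts :=
  match q with
  | None => (omap (fun x => Some (false, x)) (f (vget v i)),
             if b && isSome (vget v i) then act1 v i None Lmove else act0 v)
  | Some (false, x) => (Some (Some (true, x)), act1 v j (vget v j) Rmove)
  | Some (true, x) => (None, act1 v j (Some x) Nmove)
  end.

Definition tr_seq (Q R : finType) (r0 : R) (tp : Q -> view -> option Q * acts)
    (tq : R -> view -> option R * acts) (q : Q + R) (v : view) : option (Q + R) * acts :=
  match q with
  | inl a => let t := tp a v in (Some (if t.1 is Some a' then inl a' else inr r0), t.2)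
  | inr a => let t := tq a v in (omap inr t.1, t.2)
  end.

Definition tr_if (Q R : finType) i (f : option sym -> bool) (q0 : Q) (r0 : R)
    (tp : Q -> view -> option Q * acts) (tq : R -> view -> option R * acts)
    (q : option (Q + R)) (v : view) : option (option (Q + R)) * acts :=
  match q with
  | None => (Some (Some (if f (vget v i) then inl q0 else inr r0)), act0 v)
  | Some (inl a) => let t := tp a v in (omap (Some \o inl) t.1, t.2)
  | Some (inr a) => let t := tq a v in (omap (Some \o inr) t.1, t.2)
  end.

Definition tr_while (Q : finType) i (f : option sym -> bool) (q0 : Q)
    (tp : Q -> view -> option Q * acts) (q : option Q) (v : view) : option (option Q) * acts :=
  match q with
  | None => (if f (vget v i) then Some (Some q0) else None, act0 v)
  | Some a => let t := tp a v in (Some t.1, t.2)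
  end.

(** A result [None] means that the subprogram has finished; the enclosing construct redirects it to
    its own next control state. *)
Fixpoint tr (p : prog) : ctrl p -> view -> option (ctrl p) * acts :=
  match p return ctrl p -> view -> option (ctrl p) * acts with
  | Op i b j f => tr_op i b j f
  | Seq p q => tr_seq (ctrl0 q) (tr (p := p)) (tr (p := q))
  | If i f p q => tr_if i f (ctrl0 p) (ctrl0 q) (tr (p := p)) (tr (p := q))
  | While i f p => tr_while i f (ctrl0 p) (tr (p := p))
  end.

Definition tapes := 'I_n.+1 -> tape sym.
Definition cur (ts : tapes) : view := [ffun i => tape_current (ts i)].
Definition app_acts (a : acts) (ts : tapes) : tapes :=
  fun i => tape_move (tape_write (ts i) (a i).1) (a i).2.

Definition short (B : nat) (ts : tapes) := forall i, tape_len (ts i) <= B.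

Inductive big (Q : Type) (t : Q -> view -> option Q * acts) (B : nat) :
    Q -> tapes -> nat -> tapes -> Prop :=
| BigEnd q ts a : t q (cur ts) = (None, a) -> short B ts -> short B (app_acts a ts) ->
    big t B q ts 1 (app_acts a ts)
| BigStep q ts q' a k ts' : t q (cur ts) = (Some q', a) -> short B ts ->
    big t B q' (app_acts a ts) k ts' -> big t B q ts k.+1 ts'.

Lemma app_act0 ts : app_acts (act0 (cur ts)) ts =1 ts.
Proof. by move=> i; rewrite /app_acts /act0 !ffunE /=; case: (ts i) => [[ls m] rs]. Qed.

Lemma big_lift (Q R : Type) (g : Q -> R) (t : Q -> view -> option Q * acts)
    (u : R -> view -> option R * acts) B q ts k ts' :
  (forall q v, u (g q) v = (omap g (t q v).1, (t q v).2)) ->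
  big t B q ts k ts' -> big u B (g q) ts k ts'.
Proof.
move=> hu; elim=> {q ts k ts'}.
  by move=> q ts a e s1 s2; apply: BigEnd; rewrite // hu e.
by move=> q ts q' a k ts' e s1 _ IH; apply: BigStep IH; rewrite // hu e.
Qed.

Lemma big_seq (Q R : finType) r0 (tp : Q -> view -> option Q * acts)
    (tq : R -> view -> option R * acts) B q ts k1 ts1 k2 ts2 :
  big tp B q ts k1 ts1 -> big tq B r0 ts1 k2 ts2 ->
  big (tr_seq r0 tp tq) B (inl q) ts (k1 + k2) ts2.
Proof.
move=> h1 h2; elim: h1 h2 => {q ts k1 ts1}.
  move=> q ts a e s1 s2 h2; rewrite add1n.
  have {}h2 : big (tr_seq r0 tp tq) B (inr r0) (app_acts a ts) k2 ts2.
    by apply: big_lift h2 => q0 v /=; case: (tq q0 v).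
  by apply: BigStep h2; rewrite /= ?e.
move=> q ts q' a k ts' e s1 _ IH h2; rewrite addSn; apply: BigStep (IH h2) => //.
by rewrite /= e.
Qed.

Lemma big_while (Q : finType) i (f : option sym -> bool) (q0 : Q) tp B q ts k1 ts1 k2 ts2 :
  big tp B q ts k1 ts1 -> big (tr_while i f q0 tp) B None ts1 k2 ts2 ->
  big (tr_while i f q0 tp) B (Some q) ts (k1 + k2) ts2.
Proof.
move=> h1 h2; elim: h1 h2 => {q ts k1 ts1}.
  by move=> q ts a e s1 s2 h2; rewrite add1n; apply: BigStep h2; rewrite /= ?e.
by move=> q ts q' a k ts' e s1 _ IH h2; rewrite addSn; apply: BigStep (IH h2); rewrite /= ?e.
Qed.

(* The stack grows to the left; its top is under the head and a blank marks its
   bottom. *)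
Definition rep (B : nat) (t : tape sym) (s : seq sym) : Prop :=
  [/\ t.1.2 :: t.1.1 = rcons (map Some s) None, exists j, t.2 = nseq j None & tape_len t <= B].

Definition reps (B : nat) (ts : tapes) (S : state) : Prop :=
  size S = n.+1 /\ forall i : 'I_n.+1, rep B (ts i) (get S i).

Lemma rep_cur B t s : rep B t s -> tape_current t = ohead s.
Proof. by case: t => [[ls m] rs] [/= + _ _]; case: s => [|x s] [->]. Qed.

Lemma rep_pop B t s : rep B t s -> s <> [::] ->
  rep B (tape_move (tape_write t None) Lmove) (behead s).
Proof.
case: t => [[ls m] rs] [/= h1 [j hj] h2]; case: s h1 => [|x s] //= [_ e] _; subst ls rs.
by case: s h2 => [|y s] /= h2; split => //=; try lia; exists j.+1.
Qed.

(** Cells right of the head are blanks, left behind by earlier moves. If there is one, it is reused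
    and the tape keeps its length; otherwise the tape is exactly the stack with its bottom blank,
    and [size s < B.-1] leaves room for one more cell. *)
Lemma rep_right B t s : rep B t s -> size s < B.-1 ->
  let t' := tape_move t Rmove in
  [/\ t'.1.1 = rcons (map Some s) None, exists j, t'.2 = nseq j None & tape_len t' <= B].
Proof.
case: t => [[ls m] rs] [/= h1 [j hj] h2] hs; have := congr1 size h1; rewrite size_rcons size_map => /= -[hl].
case: rs hj h2 => [|x rs] hj h2; split => //=; try (move: h2 => /=; lia); first by exists 0.
by exists j.-1; case: (j) hj => [|j'] //= [_ ->].
Qed.

Lemma rep_write B t s x :
  [/\ t.1.1 = rcons (map Some s) None, exists j, t.2 = nseq j None & tape_len t <= B] ->
  rep B (tape_move (tape_write t (Some x)) Nmove) (x :: s).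
Proof. by case: t => [[ls m] rs] [/= -> hj hB]; split. Qed.

Lemma reps_vget B ts S i : reps B ts S -> vget (cur ts) i = top S i.
Proof.
case=> hS h; rewrite /vget /top; case: insubP => [k _ <-|]; last first.
  by rewrite -leqNgt => hi; rewrite /get nth_default // hS.
by rewrite ffunE (rep_cur (h k)).
Qed.

Lemma reps_eq B ts ts' S : reps B ts S -> ts' =1 ts -> reps B ts' S.
Proof. by case=> hS h e; split=> // i; rewrite e. Qed.

Lemma reps_short B ts S : reps B ts S -> short B ts.
Proof. by case=> _ h i; case: (h i). Qed.

Lemma reps_act1 B ts S i v w d : reps B ts S ->
  (forall k : 'I_n.+1, k = i :> nat -> rep B (tape_move (tape_write (ts k) w) d) v) ->
  reps B (app_acts (act1 (cur ts) i w d) ts) (upd S i v).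
Proof.
case=> hS h hi; split=> [|k]; first by rewrite size_upd.
rewrite get_upd /app_acts !ffunE hS eq_sym; case: eqP => [e|ne] /=.
  by rewrite {1}e ltn_ord; apply: hi; rewrite e.
by case: (ts k) (h k) => [[ls m] rs].
Qed.

Lemma size_get_tot S i : size (get S i) <= tot S.
Proof. by elim: S i => [|x S IH] [|i] //=; [lia | have := IH i; rewrite /get /=; lia]. Qed.

Lemma tot_upd S i v : i < size S -> tot (upd S i v) + size (get S i) = tot S + size v.
Proof.
elim: S i => [|x S IH] [|i] //= hi; first by rewrite /get /=; lia.
by have := IH i hi; rewrite /get /=; lia.
Qed.

(** At most three machine steps: pop, move right, write. After the move the head of tape [j] is on a
    blank above the stack, so [rep] fails there; [h2] describes this intermediate tape. *)
Lemma big_op B i b j f S ts : reps B.+1 ts S -> tot S <= B -> tot (op i b j f S) <= B ->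
  exists k ts', [/\ k <= 3, big (tr_op i b j f) B.+1 None ts k ts' & reps B.+1 ts' (op i b j f S)].
Proof.
move=> hr hS; rewrite /op; set S1 := if b then _ else _.
set a0 := (if b && isSome (vget (cur ts) i) then act1 (cur ts) i None Lmove else act0 (cur ts)).
have h1 : reps B.+1 (app_acts a0 ts) S1.
  rewrite /a0 /S1 (reps_vget _ hr); case: (b) => /=; last by apply: reps_eq hr _; apply: app_act0.
  rewrite /top; case E: (get S i) => [|x s] /=.
    by apply: reps_eq (app_act0 _); rewrite -[[::]]E upd_get.
  apply: reps_act1 => // k hk; rewrite -[s]/(behead (x :: s)); apply: rep_pop => //.
  by rewrite -E -hk; case: hr.
case Ef: (f (top S i)) => [x|] hT; last first.
  exists 1, (app_acts a0 ts); split=> //; apply: BigEnd; [|exact: reps_short hr|exact: reps_short h1].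
  by rewrite /= (reps_vget _ hr) Ef /= -(reps_vget _ hr).
set ts1 := app_acts a0 ts in h1.
set ts2 := app_acts (act1 (cur ts1) j (vget (cur ts1) j) Rmove) ts1.
set ts3 := app_acts (act1 (cur ts2) j (Some x) Nmove) ts2.
have h2 (k : 'I_n.+1) : if k == j :> nat then
   [/\ (ts2 k).1.1 = rcons (map Some (get S1 k)) None, exists l, (ts2 k).2 = nseq l None
     & tape_len (ts2 k) <= B.+1]
   else rep B.+1 (ts2 k) (get S1 k).
  rewrite /ts2 /app_acts /act1 !ffunE; case: eqP => [e|ne] /=; last first.
    by case: h1 => _ /(_ k); case: (ts1 k) => [[ls m] rs].
  have -> : tape_write (ts1 k) (vget (cur ts1) j) = ts1 k.
    rewrite /vget; case: insubP => [k' _ ek|]; last by rewrite -e ltn_ord.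
    have -> : k' = k by apply: val_inj; rewrite ek.
    by rewrite ffunE; case: (ts1 k) => [[ls m] rs].
  apply: rep_right; first by case: h1.
  have hj : j < size S1 by case: h1 => ->; rewrite -e.
  have := tot_upd (x :: get S1 j) hj; have := size_get_tot (upd S1 j (x :: get S1 j)) j.
  by rewrite get_upd eqxx hj e /=; lia.
have s2 : short B.+1 ts2 by move=> k; have := h2 k; case: eqP => _ [].
have h3 : reps B.+1 ts3 (upd S1 j (x :: get S1 j)).
  split=> [|k]; first by rewrite size_upd; case: h1.
  rewrite get_upd /ts3 /app_acts /act1 !ffunE [j == _]eq_sym; have := h2 k.
  case: eqP => [e|_] /=.
    have -> : j < size S1 by case: h1 => ->; rewrite -e.
    by rewrite -e => h; apply: rep_write.
  by case: (ts2 k) => [[ls m] rs].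
exists 3, ts3; split=> //.
apply: (BigStep (q' := Some (false, x))); [|exact: reps_short hr|].
  by rewrite /= (reps_vget _ hr) Ef /= -(reps_vget _ hr).
apply: (BigStep (q' := Some (true, x))); [by []|exact: reps_short h1|].
by apply: BigEnd; rewrite //=; apply: reps_short h3.
Qed.

Lemma big_exec B p S k S' ts : exec B p S k S' -> reps B.+1 ts S ->
  exists k' ts', [/\ k' <= 3 * k, big (tr (p := p)) B.+1 (ctrl0 p) ts k' ts' & reps B.+1 ts' S'].
Proof.
move=> e; elim: e ts => {p S k S'}.
- by move=> i b j f S h1 h2 ts hr; apply: big_op.
- move=> p q S k1 S1 k2 S2 _ IH1 _ IH2 ts /IH1[l1 [ts1 [hl1 b1 /IH2[l2 [ts2 [hl2 b2 hr]]]]]].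
  by exists (l1 + l2), ts2; split=> //; [lia | apply: big_seq b2].
- move=> i f p q S k S' hf _ IH ts hr.
  have /IH[l [ts' [hl b hr']]] : reps B.+1 (app_acts (act0 (cur ts)) ts) S.
    by apply: reps_eq hr _; apply: app_act0.
  exists l.+1, ts'; split=> //; first lia.
  apply: (BigStep (q' := Some (inl (ctrl0 p)))); [|exact: reps_short hr|].
    by rewrite /= (reps_vget _ hr) hf.
  by apply: (big_lift (g := Some \o inl)) b => q0 v /=.
- move=> i f p q S k S' hf _ IH ts hr.
  have /IH[l [ts' [hl b hr']]] : reps B.+1 (app_acts (act0 (cur ts)) ts) S.
    by apply: reps_eq hr _; apply: app_act0.
  exists l.+1, ts'; split=> //; first lia.
  apply: (BigStep (q' := Some (inr (ctrl0 q)))); [|exact: reps_short hr|].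
    by rewrite /= (reps_vget _ hr) (negPf hf).
  by apply: (big_lift (g := Some \o inr)) b => q0 v /=.
- move=> i f p S hf hB ts hr.
  have hr' : reps B.+1 (app_acts (act0 (cur ts)) ts) S by apply: reps_eq hr _; apply: app_act0.
  exists 1, (app_acts (act0 (cur ts)) ts); split=> //.
  apply: BigEnd; [|exact: reps_short hr|exact: reps_short hr'].
  by rewrite /= (reps_vget _ hr) (negPf hf).
- move=> i f p S k1 S1 k2 S2 hf _ IH1 _ IH2 ts hr.
  have /IH1[l1 [ts1 [hl1 b1 /IH2[l2 [ts2 [hl2 b2 hr2]]]]]] :
      reps B.+1 (app_acts (act0 (cur ts)) ts) S by apply: reps_eq hr _; apply: app_act0.
  exists (l1 + l2).+1, ts2; split=> //; first lia.
  apply: (BigStep (q' := Some (ctrl0 p))); [|exact: reps_short hr|].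
    by rewrite /= (reps_vget _ hr) hf.
  exact: big_while b2.
Qed.

(* The input tape has its head on the first symbol; three preliminary states move the
   head over the input, so that the tape becomes a stack whose top is the last symbol. *)
Definition ctrlM (p : prog) : finType := ('I_3 + option (ctrl p))%type.

Definition trM (p : prog) (q : ctrlM p) (v : view) : ctrlM p * acts :=
  match q with
  | inl i =>
      if val i == 0 then (inl (inord 1), act1 v 0 (vget v 0) Lmove)
      else if val i == 1 then (inl (inord 2), act1 v 0 (vget v 0) Rmove)
      else if isSome (vget v 0) then (inl (inord 2), act1 v 0 (vget v 0) Rmove)
      else (inr (Some (ctrl0 p)), act1 v 0 None Lmove)
  | inr None => (inr None, act0 v)
  | inr (Some a) => let t := tr a v in (inr t.1, t.2)
  end.

Definition compile (p : prog) : TM sym n.+1 :=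
  @Build_TM sym n.+1 (ctrlM p) (inl ord0) (fun q => if q is inr None then true else false) (@trM p).

Definition confs (p : prog) B (c : config (compile p)) k (c' : config (compile p)) : Prop :=
  tm_run k c = c' /\ forall i, i <= k -> short B (tm_run i c).2.

Lemma confs_step p B c c1 k c' : tm_step c = c1 -> short B c.2 -> @confs p B c1 k c' ->
  @confs p B c k.+1 c'.
Proof.
move=> e s [h1 h2]; split; first by rewrite /tm_run iterSr e.
by case=> [|i] hi //; rewrite /tm_run iterSr e; apply: h2.
Qed.

Lemma confs_trans p B c k c1 l c2 : @confs p B c k c1 -> @confs p B c1 l c2 ->
  @confs p B c (l + k) c2.
Proof.
rewrite /confs /tm_run => -[h1 h2] [h3 h4]; split; first by rewrite iterD h1.
move=> i hi; case: (leqP i k) => hik; first exact: h2.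
by rewrite -(subnK (ltnW hik)) iterD h1; apply: h4; lia.
Qed.

Lemma confs_big p B a ts k ts' : big (tr (p := p)) B a ts k ts' ->
  @confs p B (inr (Some a), ts) k (inr None, ts').
Proof.
elim=> {a ts k ts'}.
  move=> q ts a e s1 s2; apply: (confs_step (c1 := (inr None, app_acts a ts))) => //.
    by rewrite /= -/(cur ts) e.
  by split=> // -[].
move=> q ts q' a k ts' e s1 _; apply: confs_step => //.
by rewrite /= -/(cur ts) e.
Qed.


Definition scan_tape (ls : seq (option sym)) (w : seq sym) : tape sym :=
  if w is x :: xs then (ls, Some x, map Some xs) else (ls, None, [::]).

Definition scanning ls w (ts : tapes) : Prop :=
  ts ord0 = scan_tape ls w /\ forall k, k != ord0 -> ts k = empty_tape sym.

Lemma len_scan ls w : tape_len (scan_tape ls w) <= (size ls + size w).+1.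
Proof. by case: w => [|x w] /=; rewrite ?size_map; lia. Qed.

Lemma vget0 ts : vget (cur ts) 0 = tape_current (ts ord0).
Proof.
rewrite /vget; case: insubP => // k _ hk.
by have -> : k = ord0 by [apply: val_inj]; rewrite ffunE.
Qed.

Lemma app_act1_0 ts d :
  [/\ app_acts (act1 (cur ts) 0 (vget (cur ts) 0) d) ts ord0 = tape_move (ts ord0) d
    & forall k, k != ord0 -> app_acts (act1 (cur ts) 0 (vget (cur ts) 0) d) ts k = ts k].
Proof.
split=> [|k hk]; rewrite /app_acts /act1 !ffunE /=.
  by rewrite vget0; case: (ts ord0) => [[ls m] rs].
have -> : (k == 0 :> nat) = false by apply/negbTE; apply: contra hk => /eqP e; apply/eqP/val_inj.
by case: (ts k) => [[ls m] rs].
Qed.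

Lemma short_scan B ls w ts : scanning ls w ts -> (size ls + size w).+1 <= B -> 0 < B -> short B ts.
Proof.
move=> [h1 h2] hB B0 k; case: (k =P ord0) => [->|/eqP hk]; last by rewrite h2.
by rewrite h1; apply: leq_trans hB; apply: len_scan.
Qed.

Lemma scan_right p B ls w ts : scanning ls w ts -> (size ls + size w).+1 <= B ->
  exists2 ts', scanning (rev (map Some w) ++ ls) [::] ts' &
    @confs p B (inl (inord 2), ts) (size w) (inl (inord 2), ts').
Proof.
elim: w ls ts => [|x w IH] ls ts hs hB.
  exists ts => //; split=> // -[] // _ ; apply: short_scan hs _ _ => //=; lia.
have hs' : scanning (Some x :: ls) w (app_acts (act1 (cur ts) 0 (vget (cur ts) 0) Rmove) ts).
  have [e1 e2] := app_act1_0 ts Rmove; case: (hs) => h1 h2; split=> [|k hk].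
    by rewrite e1 h1; case: (w).
  by rewrite e2 // h2.
case: (IH _ _ hs'); first by move: hB => /=; lia.
move=> ts' h1 h2; exists ts'; first by rewrite /= rev_cons cat_rcons.
apply: confs_step h2; last by apply: short_scan hs _ _ => //=; lia.
by rewrite /= -/(cur ts) inordK // vget0 /= (proj1 hs).
Qed.

Lemma init_reps p B w : w != [::] -> (size w).+2 <= B ->
  exists2 ts, reps B ts (rev w :: nseq n [::]) &
    @confs p B (tm_init (compile p) w) (size w).+3 (inr (Some (ctrl0 p)), ts).
Proof.
case: w => // x w _ hB; set c0 := tm_init _ _.
have h0 : scanning [::] (x :: w) c0.2.
  by split=> [|k hk] /=; rewrite ?eqxx ?(negPf hk) //.
set ts1 := app_acts (act1 (cur c0.2) 0 (vget (cur c0.2) 0) Lmove) c0.2.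
(* Moving left from the first symbol visits a fresh blank, which becomes the bottom mark of the
   stack. *)
have h1 : ts1 ord0 = ([::], None, map Some (x :: w)) /\ forall k, k != ord0 -> ts1 k = empty_tape sym.
  have [e1 e2] := app_act1_0 c0.2 Lmove; case: h0 => h1 h2.
  by split=> [|k hk]; [rewrite /ts1 e1 h1 | rewrite /ts1 e2 ?h2].
set ts2 := app_acts (act1 (cur ts1) 0 (vget (cur ts1) 0) Rmove) ts1.
have h2 : scanning [:: None] (x :: w) ts2.
  have [e1 e2] := app_act1_0 ts1 Rmove; case: h1 => h1 h2.
  by split=> [|k hk]; [rewrite /ts2 e1 h1 | rewrite /ts2 e2 ?h2].
have [|ts3 h3 r3] := scan_right p (B := B) h2; first by move: hB => /=; lia.
set ts4 := app_acts (act1 (cur ts3) 0 None Lmove) ts3.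
have s3 : short B ts3.
  by apply: short_scan h3 _ _; rewrite ?size_cat ?size_rev ?size_map /=; move: hB => /=; lia.
have h4 : reps B ts4 (rev (x :: w) :: nseq n [::]).
  split=> [|k]; first by rewrite /= size_nseq.
  have [e1 e2] := app_act1_0 ts3 Lmove; case: h3 => h3 h3'.
  move: e1 e2; rewrite vget0 h3 /= -/ts4 => e1 e2.
  case: (k =P ord0) => [->|/eqP hk]; last first.
    rewrite e2 // h3' //; split=> //; [|by exists 0|by rewrite /=; lia].
    case: k {e1} hk => [[|k] hk] //= _.
    by rewrite /get /= nth_nseq; case: ifP.
  have e3 : rev [seq Some i | i <- x :: w] ++ [:: None] = rcons (map Some (rev (x :: w))) None.
    by rewrite -cats1 map_rev.
  rewrite e1 /get /=; move: e3; case E: (_ ++ _) => [|y ls] e3.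
    by case: (rev _) e3.
  split => /=; [by rewrite e3 | by exists 1 |].
  have := congr1 size E; rewrite size_cat size_rev size_map /=; move: hB => /=; lia.
exists ts4 => //.
have st1 : tm_step c0 = (inl (inord 1), ts1) by [].
have st2 : @tm_step _ _ (compile p) (inl (inord 1), ts1) = (inl (inord 2), ts2).
  by rewrite /= -/(cur ts1) inordK.
have st4 : @tm_step _ _ (compile p) (inl (inord 2), ts3) = (inr (Some (ctrl0 p)), ts4).
  by rewrite /= -/(cur ts3) inordK // vget0 /= (proj1 h3).
apply: (confs_step st1); first by apply: short_scan h0 _ _ => //=; move: hB => /=; lia.
apply: (confs_step st2).
  move=> k; case: h1 => h1 h1'; case: (k =P ord0) => [->|/eqP hk]; last by rewrite /= h1' //=; lia.
  by rewrite /= h1 /= size_map; move: hB => /=; lia.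
rewrite -(add1n (size _)); apply: confs_trans r3 _.
apply: (confs_step st4) => //; split=> // -[] // _; exact: reps_short h4.
Qed.

Lemma rep_holds B t s : rep B t s -> tape_holds t (rev s).
Proof.
case: t => [[ls m] rs] [/= h [j ->] _]; exists 1, j.
by rewrite /tape_content -cat_rcons -rev_cons h rev_rcons map_rev.
Qed.

Lemma compile_ok p w S' K B : w != [::] -> runs p (rev w :: nseq n [::]) S' K B ->
  let c0 := tm_init (compile p) w in
  exists steps : nat,
    [/\ steps <= 3 * K + size w + 3, tm_halted (tm_run steps c0),
      forall i, i <= steps -> tm_space (tm_run i c0) <= n.+1 * B.+2
      & tape_holds ((tm_run steps c0).2 ord0) (rev (get S' 0))].
Proof.
move=> hw [k hk e] c0.
have [hB _] := exec_tot e.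
have {}hB : size w <= B by move: hB => /=; rewrite size_rev; lia.
have [ts hr c1] := init_reps p (B := B.+2) hw hB.
(* A stack of height [B] takes [B.+1] cells with its bottom blank; scanning the input visits a blank
   on either side of it, hence the common bound [B.+2]. *)
have {}e := exec_weak (leqnSn B) e.
have [l [ts' [hl b hr']]] := big_exec e hr.
have [h1 h2] := confs_trans c1 (confs_big b).
exists (l + (size w).+3); split.
- lia.
- by rewrite h1.
- move=> i hi; rewrite /tm_space -[n.+1 in X in _ <= X]card_ord -sum_nat_const.
  by apply: leq_sum => j _; apply: h2.
- by rewrite h1; apply: (rep_holds (B := B.+2)); case: hr'.
Qed.

End Compile.

(** * Basic stack procedures *)

Notation "p ;; q" := (Seq p q) (at level 61, right associativity).

Definition Mov i j := Op i true j (fun o => o).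
Definition Copy i j := Op i false j (fun o => o).
Definition Push i x := Op i false i (fun _ => Some x).
Definition Pop i := Op i true i (fun _ => None).
Definition Skip := Op 0 false 0 (fun _ => None).

Definition isx (x : sym) (o : option sym) : bool := o == Some x.
Definition nonempty (o : option sym) : bool := isSome o.
Definition notsep (o : option sym) : bool := if o is Some x then x != sSep else false.

HB.lock Definition enc (s : term) : seq sym := enc_prog (gamma s).
Definition un (n : nat) : seq sym := nseq n sUn.
Arguments ren : simpl never.
Arguments un : simpl never.
Arguments addn : simpl never.
Arguments muln : simpl never.

Lemma enc_prog_cat P Q : enc_prog (P ++ Q) = enc_prog P ++ enc_prog Q.
Proof. by rewrite /enc_prog map_cat flatten_cat. Qed.

Lemma enc_var n : enc (tvar n) = sVar :: un n.
Proof. by rewrite enc.unlock /enc_prog /= cats0. Qed.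

Lemma enc_app s t : enc (tapp s t) = enc s ++ enc t ++ [:: sApp].
Proof. by rewrite enc.unlock /= !enc_prog_cat. Qed.

Lemma enc_lam s : enc (tlam s) = sLam :: enc s ++ [:: sRet].
Proof. by rewrite enc.unlock /enc_prog /= map_cat flatten_cat. Qed.

Lemma un_add a b : un a ++ un b = un (a + b).
Proof. by rewrite /un nseqD. Qed.

Lemma size_un n : size (un n) = n. Proof. by rewrite size_nseq. Qed.
Lemma rev_un n : rev (un n) = un n. Proof. by rewrite rev_nseq. Qed.
Lemma unS n : un n.+1 = sUn :: un n. Proof. by []. Qed.

Ltac klia := rewrite /get /=; do 4 rewrite ?(size_cat, size_rev, size_un) /=; lia.
Ltac st := rewrite /op /top /get /=.
Definition mvw f := While 0 f (Mov 0 1).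

Lemma runT_mvw (f : option sym -> bool) w r b : all (fun x => f (Some x)) w -> ~~ f (ohead r) ->
  runT (mvw f) [:: w ++ r; b] [:: r; rev w ++ b] (2 * size w + 1).
Proof.
move=> + hr; elim: w b => [|x w IH] b /=; first by move=> _; apply: runT_whF.
case/andP=> hx /(IH (x :: b)) h; rewrite rev_cons cat_rcons.
by apply: runT_le; [eapply runT_whT; [exact: hx | exact: runT_op | exact: h] | lia].
Qed.

Definition mvall := mvw nonempty.

Lemma runT_mvall w b : runT mvall [:: w; b] [:: [::]; rev w ++ b] (2 * size w + 1).
Proof. by have := @runT_mvw nonempty w [::] b; rewrite cats0; apply=> //; apply/allP. Qed.

Definition cpw f := While 0 f (Copy 0 2 ;; Mov 0 1).

Lemma runT_cpw (f : option sym -> bool) w r b c : all (fun x => f (Some x)) w -> ~~ f (ohead r) ->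
  runT (cpw f) [:: w ++ r; b; c] [:: r; rev w ++ b; rev w ++ c] (3 * size w + 1).
Proof.
move=> + hr; elim: w b c => [|x w IH] b c /=; first by move=> _; apply: runT_whF.
case/andP=> hx /(IH (x :: b) (x :: c)) h; rewrite rev_cons !cat_rcons.
apply: runT_le.
  eapply runT_whT; [exact: hx | | exact: h].
  exact/runT_opseq/runT_op.
by lia.
Qed.

(* The copy lands on stack 1 in the original order. *)
Definition dup f := ren [:: 0; 2] (mvw f) ;; ren [:: 2; 0; 1] (cpw nonempty).

Lemma runT_dup (f : option sym -> bool) w r c : all (fun x => f (Some x)) w -> ~~ f (ohead r) ->
  runT (dup f) [:: w ++ r; c; [::]] [:: w ++ r; w ++ c; [::]] (5 * size w + 2).
Proof.
move=> hw hr; apply: runT_le.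
  apply: (runT_callseq (S1 := [:: r; rev w ++ [::]])) => //; first exact: runT_mvw.
  have h := @runT_cpw nonempty (rev w) [::] r c.
  rewrite cats0 revK in h; rewrite /= cats0.
  apply: (@runT_call [:: 2; 0; 1] _ _ [:: [::]; w ++ r; w ++ c]) => //.
  by apply: h => //; apply/allP.
by rewrite size_rev; lia.
Qed.

Definition dupall := dup nonempty.

Lemma runT_dupall w c : runT dupall [:: w; c; [::]] [:: w; w ++ c; [::]] (5 * size w + 2).
Proof.
by have := @runT_dup nonempty w [::] c; rewrite cats0; apply => //; apply/allP.
Qed.

Definition clw f := While 0 f (Pop 0).

Lemma runT_clw (f : option sym -> bool) w r : all (fun x => f (Some x)) w -> ~~ f (ohead r) ->
  runT (clw f) [:: w ++ r] [:: r] (2 * size w + 1).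
Proof.
move=> + hr; elim: w => [|x w IH] /=; first by move=> _; apply: runT_whF.
case/andP=> hx /IH h.
by apply: runT_le; [eapply runT_whT; [exact: hx | exact: runT_op | exact: h] | lia].
Qed.

Definition clr := clw nonempty.

Lemma runT_clr w : runT clr [:: w] [:: [::]] (2 * size w + 1).
Proof. by have := @runT_clw nonempty w [::]; rewrite cats0; apply=> //; apply/allP. Qed.

Lemma all_un n : all (fun x => isx sUn (Some x)) (un n).
Proof. by rewrite /un all_nseq orbT. Qed.

Lemma all_un_notsep n : all (fun x => notsep (Some x)) (un n).
Proof. by rewrite /un all_nseq orbT. Qed.

Lemma enc_notsep s : all (fun x => notsep (Some x)) (enc s).
Proof.
elim: s => [n|s IH1 t IH2|s IH]; rewrite ?enc_var ?enc_app ?enc_lam /=.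
- exact: all_un_notsep.
- by rewrite !all_cat IH1 IH2.
- by rewrite !all_cat IH.
Qed.

(** * Balanced blocks *)

(** An abstraction on a stack is delimited by matching [sLam] with [sRet]. The brackets are
    parameters because moving a word to another stack reverses it and so exchanges their roles. *)
Inductive bal (o c : sym) : seq sym -> Prop :=
| BalNil : bal o c [::]
| BalOther x w : x != o -> x != c -> bal o c w -> bal o c (x :: w)
| BalWrap u w : bal o c u -> bal o c w -> bal o c (o :: u ++ c :: w).

Lemma bal_cat o c u w : bal o c u -> bal o c w -> bal o c (u ++ w).
Proof.
move=> h hw; elim: h => {u} //= [x u h1 h2 _ IH|u v hu _ hv IH]; first exact: BalOther.
by rewrite -catA; apply: BalWrap.
Qed.

Lemma bal_rev o c w : bal o c w -> bal c o (rev w).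
Proof.
elim=> {w} [|x w h1 h2 _ IH|u w hu IHu hw IHw]; first exact: BalNil.
  rewrite rev_cons -cats1; apply: bal_cat => //.
  by apply: BalOther => //; apply: BalNil.
rewrite rev_cons rev_cat rev_cons -cats1 cat_rcons -catA; apply: bal_cat => //.
by apply: BalWrap => //; apply: BalNil.
Qed.

Lemma bal_enc s : bal sLam sRet (enc s).
Proof.
elim: s => [n|s IH1 t IH2|s IH]; rewrite ?enc_var ?enc_app ?enc_lam.
- apply: BalOther => //; elim: n => [|n IH]; first exact: BalNil.
  by rewrite unS; apply: BalOther.
- apply: bal_cat => //; apply: bal_cat => //; apply: BalOther => //; exact: BalNil.
- by apply: BalWrap => //; apply: BalNil.
Qed.

(* Stack 2 counts the open brackets. *)
Definition block_loop o c := While 2 nonempty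
  (If 0 (isx o) (Push 2 sUn) (If 0 (isx c) (Pop 2) Skip) ;; Mov 0 1).

Definition block o c := Push 2 sUn ;; Mov 0 1 ;; block_loop o c.

(** Stated for an arbitrary continuation, because after a balanced word nested in a larger block the
    loop is still running. The counter returns to its value and never empties in between. *)
Lemma runT_block_loop o c w r b x d S' K : o != c -> bal o c w ->
  runT (block_loop o c) [:: r; rev w ++ b; x :: d] S' K ->
  runT (block_loop o c) [:: w ++ r; b; x :: d] S' (K + 5 * size w).
Proof.
move=> oc hw; elim: hw r b x d K => {w} [|y w h1 h2 _ IH|u w hu IHu hw IHw] r b x d K hK.
- by apply: runT_le hK _; lia.
- rewrite rev_cons cat_rcons in hK.
  apply: runT_le.
    eapply runT_whT; [by [] | | apply: IH hK].
    eapply runT_seq; first (apply: runT_ifF; last (apply: runT_ifF; last exact: runT_op)).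
    + by rewrite /isx /top /get /=.
    + by rewrite /isx /top /get /=.
    exact: runT_op.
  by rewrite /=; lia.
rewrite rev_cons rev_cat rev_cons -cats1 cat_rcons -!catA /= in hK.
have {}hK := IHw _ _ _ _ _ hK.
apply: runT_le.
  eapply runT_whT; first by [].
    eapply runT_seq; first (apply: runT_ifT; last exact: runT_op).
      by rewrite /isx /top /get /=.
    exact: runT_op.
  st; rewrite -catA; apply: IHu; eapply runT_whT; [by [] | | exact: hK].
  eapply runT_seq; first (apply: runT_ifF; last (apply: runT_ifT; last exact: runT_op)).
  + by rewrite /isx /top /get /= eq_sym.
  + by rewrite /isx /top /get /=.
  exact: runT_op.
by rewrite /= size_cat /=; lia.
Qed.

Lemma runT_block o c w r b : o != c -> bal o c w ->
  runT (block o c) [:: o :: w ++ c :: r; b; [::]] [:: r; c :: rev w ++ o :: b; [::]]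
    (5 * size w + 9).
Proof.
move=> oc hw; apply: runT_le.
  apply: runT_opseq; apply: runT_opseq; st; apply: runT_block_loop => //.
  eapply runT_whT; [by [] | | exact: runT_whF].
  eapply runT_seq; first (apply: runT_ifF; last (apply: runT_ifT; last exact: runT_op)).
  + by rewrite /isx /top /get /= eq_sym.
  + by rewrite /isx /top /get /=.
  exact: runT_op.
by lia.
Qed.

Lemma runT_block_enc s r b :
  runT (block sLam sRet) [:: enc (tlam s) ++ r; b; [::]] [:: r; rev (enc (tlam s)) ++ b; [::]]
    (5 * size (enc s) + 9).
Proof.
rewrite enc_lam rev_cons rev_cat /= -cats1 -!catA /=.
by have := @runT_block sLam sRet (enc s) r b isT (bal_enc s).
Qed.

Lemma runT_block_rev s r b :
  runT (block sRet sLam) [:: rev (enc (tlam s)) ++ r; b; [::]] [:: r; enc (tlam s) ++ b; [::]]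
    (5 * size (enc s) + 9).
Proof.
rewrite enc_lam rev_cons rev_cat /= -cats1 -!catA /=.
have := @runT_block sRet sLam (rev (enc s)) r b isT (bal_rev (bal_enc s)).
by rewrite revK size_rev.
Qed.

(** * Contracting a redex by substitution *)

(* Stacks: 0 program, 1 values, 2 argument, 3 one mark per enclosing abstraction,
   4 and 5 scratch. The body is read backwards from the value stack, so that pushing
   its image on stack 0 restores the order. *)
Definition count_index := While 1 (isx sUn) (Mov 1 5 ;; Mov 3 4).

(** At depth [k] there were [k + 1] marks, of which [n + 1] have been moved away by now. A mark is
    left exactly when [n < k], so the variable is bound inside the body; otherwise [n = k] and the
    argument is inserted. *)
Definition put_var := If 3 nonempty (ren [:: 5; 0] mvall ;; Mov 1 0)
  (ren [:: 5] clr ;; Pop 1 ;; ren [:: 2; 0; 5] dupall).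

Definition subst_var := count_index ;; Mov 3 4 ;; put_var ;; ren [:: 4; 3] mvall.

(** Read backwards, [sRet] opens an abstraction and [sLam] closes it. The [sLam] that takes the last
    mark is that of the redex itself: it is dropped and the loop ends. *)
Definition subst_body :=
  If 1 (isx sLam) (Pop 3 ;; If 3 nonempty (Mov 1 0) (Pop 1))
    (If 1 (isx sRet) (Push 3 sUn ;; Mov 1 0)
      (If 1 (isx sApp) (Mov 1 0) subst_var)).

Definition subst_loop := While 3 nonempty subst_body.

Definition beta :=
  Pop 0 ;; ren [:: 1; 2; 3] (block sRet sLam) ;; Pop 1 ;; Push 3 sUn ;; subst_loop ;; ren [:: 2] clr.

Lemma runT_count_index P V A n d e f :
  runT count_index [:: P; un n ++ sVar :: V; A; un (n + d); e; f]
    [:: P; sVar :: V; A; un d; un n ++ e; un n ++ f] (3 * n + 1).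
Proof.
elim: n e f => [|n IH] e f; first by apply: runT_whF.
have -> : un n.+1 ++ e = un n ++ (sUn :: e) by rewrite -[n.+1]addn1 -un_add -catA.
have -> : un n.+1 ++ f = un n ++ (sUn :: f) by rewrite -[n.+1]addn1 -un_add -catA.
apply: runT_le; first (eapply runT_whT; [by [] | | exact: IH]).
  exact/runT_opseq/runT_op.
by lia.
Qed.

Lemma runT_put_var P V u n d e :
  runT put_var [:: P; sVar :: V; enc u; un d; e; un n]
    [:: enc (subst (tvar n) (n + d) u) ++ P; V; enc u; un d; e; [::]]
    (2 * n + 5 * size (enc u) + 6).
Proof.
case: d => [|d] /=.
  rewrite addn0 eqxx; apply: runT_le.
    apply: runT_ifF; first by [].
    eapply runT_callseq; [by [] | exact: runT_clr |].
    apply: runT_opseq; st.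
    by apply: (@runT_call [:: 2; 0; 5] _ _ [:: _; _; _]); [| exact: runT_dupall].
  by klia.
have -> : (n == n + d.+1) = false by lia.
apply: runT_le.
  apply: runT_ifT; first by [].
  eapply runT_callseq; [by [] | exact: runT_mvall |].
  by rewrite rev_un enc_var; apply: runT_op.
by klia.
Qed.

Lemma runT_subst_var P V u n k : n <= k ->
  runT subst_var [:: P; un n ++ sVar :: V; enc u; un k.+1; [::]; [::]]
    [:: enc (subst (tvar n) k u) ++ P; V; enc u; un k.+1; [::]; [::]]
    (7 * n + 5 * size (enc u) + 15).
Proof.
move=> hn; have [d ed] : exists d, k = n + d by exists (k - n); lia.
subst k; have h := runT_count_index P V (enc u) n d.+1 [::] [::].
rewrite !cats0 in h; rewrite -!addnS; apply: runT_le.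
  eapply runT_seq; first exact: h.
  rewrite unS; apply: runT_opseq; st; eapply runT_seq; first exact: runT_put_var.
  have := @runT_call [:: 4; 3] mvall _ [:: [::]; rev (sUn :: un n) ++ un d].
  move=> h'; have -> : un (n + d.+1) = rev (sUn :: un n) ++ un d.
    by rewrite -unS rev_un un_add addnS addSn.
  by apply: (h' [:: _; _; _; _; _; _]); [| exact: runT_mvall].
by klia.
Qed.

(** The round may use all the time that fits under [B] on top of the current height, so its time
    bound also bounds its space; in the total it is charged [B]. *)
Lemma runs_subst_step P V A k P' V' k' S' K B :
  runT subst_body [:: P; V; A; un k.+1; [::]; [::]] [:: P'; V'; A; un k'; [::]; [::]] (B - (size P + size V + size A + k.+1) - 1) ->
  size P + size V + size A + k.+1 < B ->
  runs subst_loop [:: P'; V'; A; un k'; [::]; [::]] S' K B ->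
  runs subst_loop [:: P; V; A; un k.+1; [::]; [::]] S' (K + B) B.
Proof.
move=> h hB hK; apply: runs_weak (leqnn B); first eapply runs_whT; [by [] | | exact: hK |].
  by apply: runT_runs h (leqnn _) _; rewrite /= size_un /=; lia.
by lia.
Qed.

(** Each round consumes at least one symbol of the body and is charged [B], hence the product. A
    continuation is needed since a subterm does not end the loop. *)
Lemma runs_subst_loop s u k P V S' K B : bound k.+1 s ->
  size (enc (subst s k u)) + size P + size (enc s) + size V + 6 * size (enc u)
    + 9 * (k + size (enc s)) + 20 <= B ->
  runs subst_loop [:: enc (subst s k u) ++ P; V; enc u; un k.+1; [::]; [::]] S' K B ->
  runs subst_loop [:: P; rev (enc s) ++ V; enc u; un k.+1; [::]; [::]] S' (K + size (enc s) * B) B.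
Proof.
elim: s k P V K => [n|s IH1 t IH2|s IH] k P V K /=.
- rewrite ltnS => hn hB hK.
  apply: runs_weak (leqnn B).
    apply: runs_subst_step hK; last first.
      by move: hB; rewrite enc_var /= ?size_cat ?size_rev /= size_un; lia.
    rewrite enc_var rev_cons rev_un cat_rcons.
    apply: runT_le; first apply: runT_ifF.
    + by case: (n).
    + apply: runT_ifF; first by case: (n).
      apply: runT_ifF; first by case: (n).
      exact: runT_subst_var.
        by move: hB; rewrite enc_var /= !size_cat /= !size_un; lia.
  by rewrite enc_var /= size_un; lia.
- case/andP=> hs ht; rewrite !enc_app !size_cat /= => hB hK.
  rewrite !rev_cat -!catA /=.
  apply: runs_weak (leqnn B).
    apply: (@runs_subst_step _ _ _ _ (sApp :: P) (rev (enc t) ++ rev (enc s) ++ V) k.+1).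
    + apply: runT_le; first apply: runT_ifF; first by [].
        apply: runT_ifF; first by [].
        apply: runT_ifT; first by [].
        exact: runT_op.
      by rewrite /= ?size_cat ?size_rev /=; lia.
    + by rewrite /= ?size_cat ?size_rev /=; lia.
    (* In the reversed body the code of [t] lies above that of [s], so [t] is processed before
       [s]. *)
    apply: IH2 => //; first by rewrite /= ?size_cat !size_rev /=; lia.
    apply: IH1 => //; first by rewrite /= ?size_cat /=; lia.
    by move: hK; rewrite -!catA; apply.
  by lia.
- rewrite !enc_lam /= !size_cat /= => hs hB hK.
  rewrite rev_cons rev_cat -cats1 -!catA /=.
  apply: runs_weak (leqnn B).
    apply: (@runs_subst_step _ _ _ _ (sRet :: P) (rev (enc s) ++ sLam :: V) k.+2).
    + apply: runT_le; first apply: runT_ifF; first by [].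
        apply: runT_ifT; first by [].
        exact/runT_opseq/runT_op.
      by rewrite /= ?size_cat ?size_rev /=; lia.
    + by rewrite /= ?size_cat ?size_rev /=; lia.
    apply: IH => //; first by rewrite /= ?size_cat /=; lia.
    apply: (@runs_subst_step _ _ _ _ (sLam :: enc (subst s k.+1 u) ++ sRet :: P) V k.+1).
    + apply: runT_le; first apply: runT_ifT; first by [].
        apply: runT_opseq; st; apply: runT_ifT; first by [].
        exact: runT_op.
      by rewrite /= ?size_cat /=; lia.
    + by rewrite /= ?size_cat /=; lia.
    by move: hK; rewrite -!catA; apply.
  by lia.
Qed.

Lemma runs_beta s t P V X : bound 1 s ->
  size P + size V + size (enc (tlam s)) + size (enc (tlam t)) + size (enc (subst s 0 (tlam t))) <= X ->
  runs beta
    [:: sApp :: P; rev (enc (tlam t)) ++ rev (enc (tlam s)) ++ V; [::]; [::]; [::]; [::]]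
    [:: enc (subst s 0 (tlam t)) ++ P; V; [::]; [::]; [::]; [::]]
    ((X + 3) * (20 * X + 40)) (20 * X + 40).
Proof.
move=> hs hX; set B := 20 * X + 40.
have hsl : size (enc (tlam s)) = (size (enc s)).+2 by rewrite enc_lam /= size_cat addn1.
have htl : size (enc (tlam t)) = (size (enc t)).+2 by rewrite enc_lam /= size_cat addn1.
apply: runs_weak (leqnn B).
  apply: runs_seq.
    by apply: runT_runs (runT_op _ _ _ _ _) (leqnn _) _; rewrite /= ?size_cat ?size_rev; lia.
  st; apply: runs_seq.
    apply: runT_runs (leqnn _) _.
      eapply (@runT_call [:: 1; 2; 3]); [by [] | exact: runT_block_rev].
    by rewrite /= ?size_cat ?size_rev; lia.
  rewrite /= cats0; apply: runs_seq.
    by apply: runT_runs (runT_op _ _ _ _ _) (leqnn _) _; rewrite /= ?size_cat ?size_rev; lia.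
  st; apply: runs_seq.
    apply: runT_runs (runT_op _ _ _ _ _) (leqnn _) _.
    by rewrite /= size_behead ?size_cat ?size_rev; lia.
  st; rewrite [enc (tlam s)]enc_lam rev_cons rev_cat -cats1 -!catA /=.
  apply: runs_seq.
    apply: (@runs_subst_loop s (tlam t) 0) => //; first by rewrite /=; lia.
    apply: runs_whT.
    + by [].
    + apply: runT_runs (leqnn _) _.
        apply: runT_ifT; first by [].
        apply: runT_opseq; st; apply: runT_ifF; first by [].
        exact: runT_op.
      by rewrite /= size_cat; lia.
    by apply: runs_whF; rewrite //= size_cat; lia.
  apply: runT_runs (leqnn _) _.
    by apply: (@runT_call [:: 2] _ _ [:: [::]]); [| exact: runT_clr].
  by rewrite /= size_cat; lia.
have : size (enc s) * B <= X * B by rewrite leq_mul2r; apply/orP; right; lia.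
by rewrite mulnDl /get /=; lia.
Qed.

(** * The heap machine *)

(** A closure stores the body [u] of the abstraction [tlam u], matching [prog_rep]; programs in the
    sense of the specification are obtained by [gamma]. *)
Definition aclos := (term * nat)%type.
Definition aheap := seq (aclos * nat).

Definition aget (h : aheap) (a : nat) : option (aclos * nat) :=
  if 0 < a then onth h a.-1 else None.

Fixpoint alook (h : aheap) (a n : nat) : option aclos :=
  match n with
  | 0 => omap fst (aget h a)
  | n'.+1 => if aget h a is Some (_, b) then alook h b n' else None
  end.

Inductive item : Type := IVar of nat | ILam of term | IApp.

Fixpoint items (s : term) : seq item :=
  match s with
  | tvar n => [:: IVar n]
  | tapp s t => items s ++ items t ++ [:: IApp]
  | tlam s => [:: ILam s]
  end.

Definition hstate := (seq (seq item * nat) * seq aclos * aheap)%type.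

(** Environments are linked lists in the heap: an entry holds the value of index 0 and the address
    of the rest. A call puts the argument in front of the environment of the function. Entries are
    only appended, so old addresses keep their meaning. Exhausted tasks remain until [HRet] removes
    them. *)
Inductive hstep : hstate -> hstate -> Prop :=
| HRet a T W h : hstep (([::], a) :: T, W, h) (T, W, h)
| HLam u p a T W h : hstep ((ILam u :: p, a) :: T, W, h) ((p, a) :: T, (u, a) :: W, h)
| HVar n p a T W h g : alook h a n = Some g ->
    hstep ((IVar n :: p, a) :: T, W, h) ((p, a) :: T, g :: W, h)
| HApp p a T t s W h :
    hstep ((IApp :: p, a) :: T, t :: s :: W, h)
      ((items s.1, (size h).+1) :: (p, a) :: T, W, rcons h (t, s.2)).

Definition enc_item (i : item) : seq sym :=
  match i with IVar n => sVar :: un n | ILam u => enc (tlam u) | IApp => [:: sApp] end.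
Definition enc_items (p : seq item) : seq sym := flatten (map enc_item p).
(* The closing [sRet] of an abstraction doubles as the end marker of a task. *)
Definition enc_tasks (T : seq (seq item * nat)) : seq sym :=
  flatten [seq enc_items x.1 ++ [:: sRet] | x <- T].
Definition enc_addrs (A : seq nat) : seq sym := flatten [seq un a ++ [:: sSep] | a <- A].
Definition enc_vals (W : seq term) : seq sym := flatten [seq rev (enc (tlam u)) | u <- W].
HB.lock Definition entry (e : aclos * nat) : seq sym :=
  enc (tlam e.1.1) ++ sSep :: un e.1.2 ++ sSep :: un e.2 ++ [:: sSep].
Definition enc_aheap (h : aheap) : seq sym := flatten (map entry h).

Definition heap_stacks (x : hstate) : state :=
  let: (T, W, h) := x in
  [:: enc_tasks T; enc_addrs (map snd T); enc_vals (map fst W); enc_addrs (map snd W);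
      rev (enc_aheap h); un (size h); [::]; [::]; [::]; [::]].

Lemma enc_items_term s : enc_items (items s) = enc s.
Proof.
elim: s => [n|s IHs t IHt|s _]; rewrite ?enc_var ?enc_app /enc_items /= ?cats0 //.
by rewrite !map_cat !flatten_cat -IHs -IHt.
Qed.

(** * Traversal of the encoded heap *)

Definition mvfield := mvw notsep ;; Mov 0 1.

Lemma runT_mvfield w r b : all (fun x => notsep (Some x)) w ->
  runT mvfield [:: w ++ sSep :: r; b] [:: r; sSep :: rev w ++ b] (2 * size w + 2).
Proof.
move=> hw; apply: runT_le.
  by eapply runT_seq; [exact: runT_mvw | exact: runT_op].
by lia.
Qed.

Lemma entry_cat u c b r :
  entry (u, c, b) ++ r = enc (tlam u) ++ sSep :: un c ++ sSep :: un b ++ sSep :: r.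
Proof. by rewrite entry.unlock /= -catA /= -catA /= -catA. Qed.

Lemma rev_entry_cat u c b r :
  rev (entry (u, c, b)) ++ r = sSep :: un b ++ sSep :: un c ++ sSep :: rev (enc (tlam u)) ++ r.
Proof.
rewrite entry.unlock /= !(rev_cat, rev_cons) -!cats1 !rev_un.
by rewrite /= ?(catA, cat_rcons) -?catA /= -?catA /= -?catA.
Qed.

Lemma size_entry u c b : size (entry (u, c, b)) = size (enc (tlam u)) + c + b + 3.
Proof. by rewrite entry.unlock !size_cat /= !size_cat /= !size_cat /= !size_un; lia. Qed.

Definition mventry := mvfield ;; mvfield ;; mvfield.

Lemma runT_mventry e r b :
  runT mventry [:: entry e ++ r; b] [:: r; rev (entry e) ++ b] (2 * size (entry e)).
Proof.
case: e => [[u c] b']; rewrite entry_cat rev_entry_cat.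
apply: runT_le.
  eapply runT_seq; first by apply: runT_mvfield; exact: enc_notsep.
  eapply runT_seq; first by apply: runT_mvfield; exact: all_un_notsep.
  by rewrite -{2}[un c]rev_un -{2}[un b']rev_un; apply: runT_mvfield; exact: all_un_notsep.
by rewrite size_entry !size_un; lia.
Qed.

Definition skip_entries := While 2 nonempty (Pop 2 ;; ren [:: 1; 0] mventry).
(** Addresses count from the oldest entry, which lies at the bottom. The heap is unrolled completely
    and all entries before the wanted one are put back; [Pop 2] accounts for counting from 1. *)
Definition seek := ren [:: 0; 1] mvall ;; Pop 2 ;; skip_entries.

Lemma enc_aheap_cat h1 h2 : enc_aheap (h1 ++ h2) = enc_aheap h1 ++ enc_aheap h2.
Proof. by rewrite /enc_aheap map_cat flatten_cat. Qed.

Lemma enc_aheap_cons e h : enc_aheap (e :: h) = entry e ++ enc_aheap h.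
Proof. by []. Qed.

Lemma runT_skip_entries h1 r b :
  runT skip_entries [:: b; enc_aheap h1 ++ r; un (size h1)] [:: rev (enc_aheap h1) ++ b; r; [::]]
    (3 * size (enc_aheap h1) + 1).
Proof.
elim: h1 b => [|e h1 IH] b; first by apply: runT_whF.
have -> : enc_aheap (e :: h1) = entry e ++ enc_aheap h1 by [].
rewrite rev_cat -!catA /=; apply: runT_le.
  eapply runT_whT; [by [] | | exact: (IH (rev (entry e) ++ b))].
  apply: runT_opseq; st.
  apply: (@runT_call [:: 1; 0] _ _ [:: enc_aheap h1 ++ r; rev (entry e) ++ b]) => //.
  exact: runT_mventry.
have : 3 <= size (entry e) by case: (e) => [[u c] b']; rewrite size_entry; lia.
by rewrite /get /= size_cat; lia.
Qed.

Lemma runT_seek h1 h2 :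
  runT seek [:: rev (enc_aheap (h1 ++ h2)); [::]; un (size h1).+1]
    [:: rev (enc_aheap h1); enc_aheap h2; [::]] (5 * size (enc_aheap (h1 ++ h2)) + 3).
Proof.
rewrite enc_aheap_cat; apply: runT_le.
  eapply runT_callseq; [by [] | exact: runT_mvall |].
  apply: runT_opseq; st; rewrite cats0 revK.
  by have := runT_skip_entries h1 (enc_aheap h2) [::]; rewrite cats0; apply.
by rewrite /get /= size_rev !size_cat; lia.
Qed.

(* Stacks: 0 heap, 1 scratch, 2 address, 3 index, 4 values, 5 value addresses. *)
Definition hop := ren [:: 0; 1; 2] seek ;; ren [:: 1; 0] mvfield ;; ren [:: 1; 0] mvfield ;;
  ren [:: 1; 0; 2] (cpw (isx sUn)) ;; ren [:: 1; 0] mvall.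

Definition fetch := ren [:: 0; 1; 2] seek ;; ren [:: 1; 0; 4] (cpw notsep) ;; Push 5 sSep ;; Mov 1 0 ;;
  ren [:: 1; 0; 5] (cpw (isx sUn)) ;; ren [:: 1; 0] mvall.

Definition look := While 3 nonempty (Pop 3 ;; hop) ;; fetch.

Lemma runT_hop h1 u c b h2 N W WA : let h := h1 ++ ((u, c), b) :: h2 in
  runT hop [:: rev (enc_aheap h); [::]; un (size h1).+1; N; W; WA]
    [:: rev (enc_aheap h); [::]; un b; N; W; WA] (10 * size (enc_aheap h) + 10).
Proof.
move=> h; apply: runT_le.
  eapply runT_callseq; [by [] | exact: runT_seek |].
  have -> : enc_aheap (((u, c), b) :: h2) = entry ((u, c), b) ++ enc_aheap h2 by [].
  rewrite entry_cat.
  eapply runT_callseq; [by [] | by st; apply: runT_mvfield; exact: enc_notsep |].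
  eapply runT_callseq; [by [] | by st; apply: runT_mvfield; exact: all_un_notsep |].
  eapply runT_callseq; [by [] | by st; apply: runT_cpw; first exact: all_un |].
  rewrite !rev_un cats0.
  have -> : rev (enc_aheap h) = rev (sSep :: enc_aheap h2) ++
      un b ++ sSep :: un c ++ sSep :: rev (enc (tlam u)) ++ rev (enc_aheap h1).
    by rewrite /h enc_aheap_cat rev_cat enc_aheap_cons rev_cat -catA rev_entry_cat rev_cons cat_rcons ?rev_un.
  by apply: (@runT_call [:: 1; 0] _ _ [:: _; _]) => //; exact: runT_mvall.
rewrite /get /= /h enc_aheap_cat enc_aheap_cons !size_cat size_entry.
by do 3!rewrite ?(size_cat, size_rev, size_un) /=; lia.
Qed.

Lemma runT_fetch h1 u c b h2 W WA : let h := h1 ++ ((u, c), b) :: h2 in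
  runT fetch [:: rev (enc_aheap h); [::]; un (size h1).+1; [::]; W; WA]
    [:: rev (enc_aheap h); [::]; [::]; [::]; rev (enc (tlam u)) ++ W; un c ++ sSep :: WA]
    (11 * size (enc_aheap h) + 10).
Proof.
move=> h; apply: runT_le.
  eapply runT_callseq; [by [] | exact: runT_seek |].
  have -> : enc_aheap (((u, c), b) :: h2) = entry ((u, c), b) ++ enc_aheap h2 by [].
  rewrite entry_cat.
  eapply runT_callseq; [by [] | by st; apply: runT_cpw; first exact: enc_notsep |].
  apply: runT_opseq; st; apply: runT_opseq; st.
  eapply runT_callseq; [by [] | by st; apply: runT_cpw; first exact: all_un |].
  rewrite !rev_un.
  have -> : rev (enc_aheap h) = rev (sSep :: un b ++ sSep :: enc_aheap h2) ++
      un c ++ sSep :: rev (enc (tlam u)) ++ rev (enc_aheap h1).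
    by rewrite /h enc_aheap_cat rev_cat enc_aheap_cons rev_cat -catA rev_entry_cat rev_cons cat_rcons rev_cat rev_cons -catA cat_rcons rev_un.
  by apply: (@runT_call [:: 1; 0] _ _ [:: _; _]) => //; exact: runT_mvall.
rewrite /get /= /h enc_aheap_cat enc_aheap_cons !size_cat size_entry.
by do 3!rewrite ?(size_cat, size_rev, size_un) /=; lia.
Qed.

Lemma onth_split (T : Type) (s : seq T) i x : onth s i = Some x ->
  exists s1 s2, s = s1 ++ x :: s2 /\ size s1 = i.
Proof.
elim: s i => [|y s IH] [|i] //=; first by case=> ->; exists [::], s.
by case/IH=> s1 [s2 [-> <-]]; exists (y :: s1), s2.
Qed.

Lemma aget_split h a e : aget h a = Some e ->
  exists h1 h2, h = h1 ++ e :: h2 /\ a = (size h1).+1.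
Proof.
rewrite /aget; case: a => [|a] //= E; have [h1 [h2 [-> <-]]] := onth_split E.
by exists h1, h2.
Qed.


(** Every address reached by a hop is written in unary inside the heap, hence at most its encoded
    size, so all hops fit under the same [B]. Each of the [n] hops scans the heap again, which makes
    the time superlinear. *)
Lemma runs_look h a n u c W WA B : alook h a n = Some (u, c) ->
  a <= size (enc_aheap h) ->
  30 * (size (enc_aheap h) + n + size W + size WA) + 50 <= B ->
  runs look [:: rev (enc_aheap h); [::]; un a; un n; W; WA]
    [:: rev (enc_aheap h); [::]; [::]; [::]; rev (enc (tlam u)) ++ W; un c ++ sSep :: WA]
    ((n + 2) * B) B.
Proof.
move=> hl ha hB.
(* After [n] hops the wanted closure is the first component of the entry at [a']; only the fetch
   remains. *)
suff [a' [ha' hl' hr]] : exists a', [/\ a' <= size (enc_aheap h), alook h a' 0 = Some (u, c) &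
    runs (While 3 nonempty (Pop 3 ;; hop))
      [:: rev (enc_aheap h); [::]; un a; un n; W; WA]
      [:: rev (enc_aheap h); [::]; un a'; [::]; W; WA] (n * B + 1) B].
  move: hl' => /=; case E: (aget h a') => [[[u' c'] b]|] //= [eu ec]; subst u' c'.
  have [h1 [h2 [e1 e2]]] := aget_split E.
  apply: runs_weak (leqnn B).
    apply: runs_seq hr _; apply: runT_runs (leqnn _) _.
      by rewrite e1 e2; exact: runT_fetch.
    by rewrite -e1 /= size_rev !size_un; lia.
  by rewrite -e1; lia.
elim: n a ha hl hB => [|n IH] a ha hl hB.
  by exists a; split=> //; apply: runs_whF; rewrite //= size_rev !size_un; lia.
move: hl => /=; case E: (aget h a) => [[[u' c'] b]|] //= hl.
have [h1 [h2 [e1 e2]]] := aget_split E.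
have hb : b <= size (enc_aheap h).
  by rewrite e1 enc_aheap_cat enc_aheap_cons !size_cat size_entry; lia.
have [|a' [ha' hl' hr]] := IH b hb hl; first by lia.
exists a'; split=> //; apply: runs_weak (leqnn B).
  eapply runs_whT; [by [] | | exact: hr].
  apply: runT_runs (leqnn _) _.
    by apply: runT_opseq; st; rewrite e1 e2; exact: runT_hop.
  by rewrite -e1 /= size_rev !size_un; lia.
by rewrite -e1; lia.
Qed.

(* Stacks: 0 tasks, 1 task addresses, 2 values, 3 value addresses, 4 heap (newest
   entry on top), 5 its length in unary, 6 to 9 scratch. *)
Definition heap_ret := Pop 0 ;; ren [:: 1] (clw (isx sUn)) ;; Pop 1.
Definition heap_lam := ren [:: 0; 2; 9] (block sLam sRet) ;; Push 3 sSep ;;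
  ren [:: 1; 3; 9] (dup (isx sUn)).
Definition move_addr := ren [:: 3; 4] (mvw (isx sUn)) ;; Pop 3 ;; Push 4 sSep.
Definition heap_app := Pop 0 ;; ren [:: 2; 6; 9] (block sRet sLam) ;; ren [:: 6; 4] mvall ;; Push 4 sSep ;;
  move_addr ;; move_addr ;; ren [:: 2; 0; 9] (block sRet sLam) ;; Pop 0 ;;
  Push 5 sUn ;; Push 1 sSep ;; ren [:: 5; 1; 9] dupall.
Definition heap_var := Pop 0 ;; ren [:: 0; 8] (mvw (isx sUn)) ;; ren [:: 1; 7; 9] (dup (isx sUn)) ;;
  ren [:: 4; 6; 7; 8; 2; 3] look.
Definition heap_step :=
  If 0 (isx sRet) heap_ret (If 0 (isx sLam) heap_lam (If 0 (isx sApp) heap_app heap_var)).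

Lemma runT_heap_ret T a TA W WA H K :
  runT heap_ret [:: sRet :: T; un a ++ sSep :: TA; W; WA; H; K; [::]; [::]; [::]; [::]]
    [:: T; TA; W; WA; H; K; [::]; [::]; [::]; [::]] (2 * a + 3).
Proof.
apply: runT_le.
  apply: runT_opseq; st.
  eapply runT_callseq; [by [] | by st; apply: runT_clw; first exact: all_un |].
  exact: runT_op.
by klia.
Qed.

Lemma runT_heap_lam u T a TA W WA H K :
  runT heap_lam [:: enc (tlam u) ++ T; un a ++ sSep :: TA; W; WA; H; K; [::]; [::]; [::]; [::]]
    [:: T; un a ++ sSep :: TA; rev (enc (tlam u)) ++ W; un a ++ sSep :: WA; H; K;
      [::]; [::]; [::]; [::]] (5 * size (enc (tlam u)) + 5 * a + 12).
Proof.
apply: runT_le.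
  eapply runT_callseq; [by [] | exact: runT_block_enc |].
  apply: runT_opseq; st.
  apply: (@runT_call [:: 1; 3; 9] _ _ [:: _; _; _]) => //.
  by apply: runT_dup; first exact: all_un.
rewrite enc_lam; klia.
Qed.

Lemma runT_move_addr T TA W a WA H K A B C D :
  runT move_addr [:: T; TA; W; un a ++ sSep :: WA; H; K; A; B; C; D]
    [:: T; TA; W; WA; sSep :: un a ++ H; K; A; B; C; D] (2 * a + 3).
Proof.
apply: runT_le.
  eapply runT_callseq; [by [] | by st; apply: runT_mvw; first exact: all_un |].
  by rewrite rev_un; apply: runT_opseq; apply: runT_op.
by klia.
Qed.

Lemma runT_heap_app T TA t s ct cs W WA H n :
  runT heap_app
    [:: sApp :: T; TA; rev (enc (tlam t)) ++ rev (enc (tlam s)) ++ W;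
       un ct ++ sSep :: un cs ++ sSep :: WA; H; un n; [::]; [::]; [::]; [::]]
    [:: enc s ++ sRet :: T; un n.+1 ++ sSep :: TA; W; WA; rev (entry (t, ct, cs)) ++ H; un n.+1;
       [::]; [::]; [::]; [::]]
    (7 * size (enc (tlam t)) + 5 * size (enc (tlam s)) + 2 * ct + 2 * cs + 5 * n + 50).
Proof.
apply: runT_le.
  apply: runT_opseq; st.
  eapply runT_callseq; [by [] | exact: runT_block_rev |].
  eapply runT_callseq; [by [] | st; exact: runT_mvall |].
  apply: runT_opseq; st.
  eapply runT_seq; first exact: runT_move_addr.
  eapply runT_seq; first exact: runT_move_addr.
  eapply runT_callseq; [by [] | exact: runT_block_rev |].
  apply: runT_opseq; st; rewrite [enc (tlam s)]enc_lam /= -catA /= cats0.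
  apply: runT_opseq; st.
  apply: runT_opseq; st.
  rewrite rev_entry_cat.
  apply: (@runT_call [:: 5; 1; 9] _ _ [:: _; _; _]) => //.
  exact: runT_dupall.
rewrite !enc_lam; klia.
Qed.

Lemma alook_le h a n g : alook h a n = Some g -> a <= size (enc_aheap h).
Proof.
have hs : size h <= size (enc_aheap h).
  elim: h => [|[[u c] b] h IH] //; rewrite enc_aheap_cons size_cat size_entry /=; lia.
have ha e : aget h a = Some e -> a <= size (enc_aheap h).
  by case/aget_split=> h1 [h2 [e1 ->]]; apply: leq_trans hs; rewrite e1 size_cat /=; lia.
by case: n => [|n] /=; case E: (aget h a) => [e|] // _; apply: ha E.
Qed.

Lemma runs_heap_var n T a TA W WA h u c K X :
  alook h a n = Some (u, c) -> ~~ isx sUn (ohead T) ->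
  n + size T + a + size TA + size W + size WA + size (enc_aheap h) + size K + 10 <= X ->
  runs heap_var
    [:: sVar :: un n ++ T; un a ++ sSep :: TA; W; WA; rev (enc_aheap h); K; [::]; [::]; [::]; [::]]
    [:: T; un a ++ sSep :: TA; rev (enc (tlam u)) ++ W; un c ++ sSep :: WA; rev (enc_aheap h); K;
       [::]; [::]; [::]; [::]] ((X + 3) * (100 * X)) (100 * X).
Proof.
move=> hl hT hX; set B := 90 * X.
apply: runs_weak.
- apply: (@runs_seq _ _ _ _ _ _ _ (100 * X)).
    apply: runT_runs (runT_op _ _ _ _ _) (leqnn _) _.
    by rewrite /= !size_cat size_rev /= !size_un; lia.
  st; apply: runs_seq.
    apply: runT_runs (leqnn _) _.
      by apply: (@runT_call [:: 0; 8] _ _ [:: _; _]) => //; apply: runT_mvw; first exact: all_un.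
    by rewrite /= !size_cat size_rev /= !size_un; lia.
  st; apply: runs_seq.
    apply: runT_runs (leqnn _) _.
      by apply: (@runT_call [:: 1; 7; 9] _ _ [:: _; _; _]) => //; apply: runT_dup; first exact: all_un.
    by rewrite /= !size_cat !size_rev /= !size_un; lia.
  rewrite rev_un !cats0.
  apply: runs_weak (leqnn _) _.
    apply: (@runs_call [:: 4; 6; 7; 8; 2; 3] _ _ [:: _; _; _; _; _; _]) => //.
    apply: (runs_look (B := B) hl); first exact: alook_le hl.
    by rewrite /B /get /=; lia.
  by rewrite /= !size_cat size_rev /= !size_un /B; lia.
- have : (n + 2) * B <= (X + 2) * B by rewrite leq_mul2r; apply/orP; right; lia.
  rewrite !size_un /B; nia.
- by [].
Qed.

(** This delimits a unary index on the task stack, where no separator follows it. *)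
Lemma tasks_head p a T : ~~ isx sUn (ohead (enc_tasks ((p, a) :: T))).
Proof. by case: p => [|[n|u|] p]; rewrite /enc_tasks /enc_items /= ?enc_lam. Qed.

Lemma enc_aheap_rcons h e : enc_aheap (rcons h e) = enc_aheap h ++ entry e.
Proof. by rewrite -cats1 enc_aheap_cat enc_aheap_cons /enc_aheap /= cats0. Qed.

Lemma runs_heap_step x y X : hstep x y -> tot (heap_stacks x) + tot (heap_stacks y) <= X ->
  runs heap_step (heap_stacks x) (heap_stacks y) ((X + 20) * (200 * X + 2000)) (200 * X + 2000).
Proof.
set B := 200 * X + 2000.
case=> {x y}.
- move=> a T W h hX; apply: (@runs_weak _ _ _ B B) => //; last by nia.
  rewrite /= /enc_tasks /enc_items /enc_addrs /= -!catA /= in hX *.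
  apply: runT_runs.
  + by apply: runT_ifT; [| exact: runT_heap_ret].
  + by move: hX; rewrite /B /= !size_cat !size_un /=; lia.
  + by move: hX; rewrite /B /= !size_cat !size_un /=; lia.
- move=> u p a T W h hX; apply: (@runs_weak _ _ _ B B) => //; last by nia.
  rewrite /= /enc_tasks /enc_items /enc_addrs /= -!catA /= in hX *.
  apply: runT_runs.
  + apply: runT_ifF; first by rewrite enc_lam.
    apply: runT_ifT; first by rewrite enc_lam.
    exact: runT_heap_lam.
  + by move: hX; rewrite /B /= !size_cat !size_rev !size_un /=; lia.
  + by move: hX; rewrite /B /= !size_cat !size_rev !size_un /=; lia.
- move=> n p a T W h [u c] hl hX.
  rewrite /= /enc_tasks /enc_items /enc_addrs /= -!catA /= in hX *.
  apply: runs_weak.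
  + apply: runs_ifF; first by [].
    apply: runs_ifF; first by [].
    apply: runs_ifF; first by [].
    apply: (runs_heap_var (X := X + 15)) hl _ _.
      by have := tasks_head p a T; rewrite /enc_tasks /= -catA.
    by move: hX; rewrite /= !size_cat !size_rev !size_un /= ?size_cat /=; lia.
  + by rewrite /B; nia.
  + by rewrite /B; lia.
move=> p a T [t ct] [s cs] W h hX; apply: (@runs_weak _ _ _ B B) => //; last by nia.
rewrite /= size_rcons enc_aheap_rcons rev_cat in hX *.
rewrite /= /enc_tasks /= -/(enc_tasks _) enc_items_term /enc_items /enc_addrs /= -!catA /= in hX *.
apply: runT_runs.
+ apply: runT_ifF; first by [].
  apply: runT_ifF; first by [].
  apply: runT_ifT; first by [].
  exact: runT_heap_app.
+ by move: hX; rewrite /B; do 3!rewrite ?(size_cat, size_rev, size_un) /=; lia.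
+ by move: hX; rewrite /B; do 3!rewrite ?(size_cat, size_rev, size_un) /=; lia.
Qed.

(** * Writing the output *)

Lemma bits_fuel f a : a <= f -> bits f a = enc_addr a.
Proof.
have H n f1 f2 : n <= f1 -> n <= f2 -> bits f1 n = bits f2 n.
  elim: f1 f2 n => [|f1 IH] [|f2] [|n] //= h1 h2.
  by congr (_ :: _); apply: IH; lia.
by move=> ha; apply: H.
Qed.

Lemma enc_addrE a : 0 < a -> enc_addr a = (if odd a then sB1 else sB0) :: enc_addr a./2.
Proof.
case: a => [|a] // _; rewrite {1}/enc_addr /= bits_fuel //; last by lia.
Qed.

Lemma size_enc_addr a : size (enc_addr a) <= a.
Proof.
rewrite /enc_addr; move: {1 3}a => f; elim: f a => [|f IH] a //=.
by case: eqP => // _ /=; exact: IH.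
Qed.

(** Binary increment, least significant bit first: the carry turns the initial ones into zeros and
    sets the next bit. [behead] covers both cases of that bit, a zero to be overwritten or the end
    of the word. *)
Lemma enc_addrS a : exists j r,
  [/\ enc_addr a = nseq j sB1 ++ r, ohead r != Some sB1
    & enc_addr a.+1 = nseq j sB0 ++ sB1 :: behead r].
Proof.
elim/ltn_ind: a => a IH; case: (posnP a) => [->|a0]; first by exists 0, [::].
rewrite (enc_addrE a0) (@enc_addrE a.+1) // [odd a.+1]/=.
case: ifP => oa /=.
  have /IH[j [r [e1 e2 e3]]] : a./2 < a by lia.
  exists j.+1, r; split=> //=; first by rewrite e1.
  by rewrite -e3; congr (_ :: enc_addr _); lia.
by exists 0, (sB0 :: enc_addr a./2); split=> //=; congr (_ :: enc_addr _); lia.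
Qed.

Definition incr := While 0 (isx sB1) (Pop 0 ;; Push 1 sUn) ;; Pop 0 ;; Push 0 sB1 ;;
  While 1 nonempty (Pop 1 ;; Push 0 sB0).

Lemma runT_incr a : runT incr [:: enc_addr a; [::]] [:: enc_addr a.+1; [::]] (6 * a + 4).
Proof.
have [j [r [e1 e2 e3]]] := enc_addrS a.
have hj : j <= a.
  by have := size_enc_addr a; rewrite e1 size_cat size_nseq; lia.
rewrite e1 e3.
have ones m : runT (While 0 (isx sB1) (Pop 0 ;; Push 1 sUn)) [:: nseq j sB1 ++ r; un m]
    [:: r; un (j + m)] (3 * j + 1).
  elim: (j) m => [|i IH] m; first by apply: runT_whF.
  rewrite addSnnS; apply: runT_le; first (eapply runT_whT; [by [] | | exact: (IH m.+1)]).
    exact/runT_opseq/runT_op.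
  by lia.
have zeros m b : runT (While 1 nonempty (Pop 1 ;; Push 0 sB0)) [:: b; un m]
    [:: nseq m sB0 ++ b; un 0] (3 * m + 1).
  elim: m b => [|i IH] b; first by apply: runT_whF.
  have -> : nseq i.+1 sB0 ++ b = nseq i sB0 ++ sB0 :: b.
    by rewrite -[i.+1]addn1 nseqD -catA.
  apply: runT_le; first (eapply runT_whT; [by [] | | exact: IH]).
    exact/runT_opseq/runT_op.
  by lia.
apply: runT_le.
  eapply runT_seq; first exact: (ones 0).
  apply: runT_opseq; st; apply: runT_opseq; st.
  rewrite addn0; exact: zeros.
by lia.
Qed.

(* Stacks: 0 output, 1 fields with unary addresses, 2 and 3 scratch. *)
Definition count_up := While 1 (isx sUn) (Pop 1 ;; ren [:: 2; 3] incr).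
Definition conv := count_up ;; Pop 1 ;; ren [:: 2; 0] mvall.

Lemma runs_count_up io a m r B : 20 * (a + m) + size io + size r + 20 <= B ->
  runs count_up [:: io; un a ++ sSep :: r; enc_addr m; [::]]
    [:: io; sSep :: r; enc_addr (a + m); [::]] (a * B + 1) B.
Proof.
elim: a m => [|a IH] m hB.
  by apply: runs_whF => //=; have := size_enc_addr m; lia.
rewrite (addSnnS a m).
apply: runs_weak (leqnn B); first (eapply runs_whT; [by [] | | apply: (IH m.+1); lia]).
  apply: runT_runs (leqnn _) _.
    by apply: runT_opseq; st; apply: (@runT_call [:: 2; 3] _ _ [:: _; _]) => //; exact: runT_incr.
  by rewrite /= size_cat size_un /=; have := size_enc_addr m; lia.
by lia.
Qed.

Lemma runs_conv io a r B : 30 * a + size io + size r + 30 <= B ->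
  runs conv [:: io; un a ++ sSep :: r; [::]; [::]]
    [:: rev (enc_addr a) ++ io; r; [::]; [::]] ((a + 2) * B) B.
Proof.
move=> hB; have ha := size_enc_addr a.
have h := @runs_count_up io a 0 r B; rewrite addn0 in h.
apply: runs_weak (leqnn B).
  apply: runs_seq; first by apply: h; lia.
  apply: runT_runs (leqnn _) _.
    apply: runT_opseq; st.
    by apply: (@runT_call [:: 2; 0] _ _ [:: _; _]) => //; exact: runT_mvall.
  by rewrite /get /=; lia.
by rewrite /get /=; lia.
Qed.

(** The outer [sLam] and [sRet] are dropped because a closure of the output lists the program of the
    body only. *)
Definition emit_clos := Push 0 sLpar ;; Pop 1 ;; ren [:: 1; 0] (mvw notsep) ;; Pop 0 ;; Pop 1 ;;
  Push 0 sSep ;; conv ;; Push 0 sRpar.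
Definition emit_entry := Push 0 sLpar ;; emit_clos ;; Push 0 sSep ;; conv ;; Push 0 sRpar.
Definition emit_heap := While 1 nonempty emit_entry.

Definition hclos (g : aclos) : hclosure := (gamma g.1, g.2).
Definition hheap (h : aheap) : heap := [seq (hclos e.1, e.2) | e <- h].

Lemma enc_closE u c : enc_clos (hclos (u, c)) = sLpar :: enc u ++ sSep :: enc_addr c ++ [:: sRpar].
Proof. by rewrite enc.unlock. Qed.

Lemma runs_opseq i b j f q S S' K B : tot S < B ->
  runs q (op i b j f S) S' K B -> runs (Seq (Op i b j f) q) S S' (1 + K) B.
Proof.
move=> hB; apply: runs_seq; apply: runT_runs (runT_op _ _ _ _ _) (leqnn _) _; lia.
Qed.

Lemma runs_callseq r p q G S1 S2 K1 K2 B : fits G r -> runT p (map (get G) r) S1 K1 ->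
  tot G + K1 <= B -> runs q (embed G r S1) S2 K2 B -> runs (Seq (ren r p) q) G S2 (K1 + K2) B.
Proof.
move=> hG h hB; apply: runs_seq; apply: runT_runs (leqnn _) hB.
exact: runT_call.
Qed.

Lemma runs_emit_clos io u c r B :
  40 * (size (enc (tlam u)) + c + size io + size r) + 60 <= B ->
  runs emit_clos [:: io; enc (tlam u) ++ sSep :: un c ++ sSep :: r; [::]; [::]]
    [:: rev (enc_clos (hclos (u, c))) ++ io; r; [::]; [::]] ((c + 3) * B) B.
Proof.
rewrite enc_closE enc_lam /= size_cat /= => hB; have hc := size_enc_addr c.
have -> : rev (sLpar :: enc u ++ sSep :: enc_addr c ++ [:: sRpar]) ++ io =
    sRpar :: rev (enc_addr c) ++ sSep :: rev (enc u) ++ sLpar :: io.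
  rewrite !(rev_cons, rev_cat) -!cats1 /= -!catA /=.
  by rewrite ?cat_rcons -?catA /= -?catA /= -?catA /= ?cat_rcons.
apply: runs_weak (leqnn B).
  apply: runs_opseq; first by klia.
  st; apply: runs_opseq; first by klia.
  st; rewrite -!catA /=.
  have e : enc u ++ sRet :: sSep :: un c ++ sSep :: r =
     (enc u ++ [:: sRet]) ++ sSep :: un c ++ sSep :: r by rewrite -catA.
  apply: (@runs_callseq _ _ _ _ [:: sSep :: un c ++ sSep :: r; sRet :: rev (enc u) ++ sLpar :: io]) => //.
  - rewrite /get /= e; have := @runT_mvw notsep (enc u ++ [:: sRet]) (sSep :: un c ++ sSep :: r) (sLpar :: io).
    rewrite rev_cat /= => h; apply: h => //.
    by rewrite all_cat enc_notsep.
  - by klia.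
  apply: runs_opseq; first by klia.
  st; apply: runs_opseq; first by klia.
  st; apply: runs_opseq; first by klia.
  st; apply: runs_seq.
    by apply: runs_conv; rewrite /= !size_cat /= !size_rev /=; lia.
  apply: runT_runs (runT_op _ _ _ _ _) (leqnn _) _.
  by klia.
by rewrite size_cat /=; lia.
Qed.

Lemma enc_entryE u c b : enc_entry (hclos (u, c), b) =
  sLpar :: enc_clos (hclos (u, c)) ++ sSep :: enc_addr b ++ [:: sRpar].
Proof. by []. Qed.

Lemma size_enc_clos u c : size (enc_clos (hclos (u, c))) <= size (enc (tlam u)) + c + 1.
Proof.
by have := size_enc_addr c; rewrite enc_closE enc_lam; klia.
Qed.

Lemma size_enc_entry u c b : size (enc_entry (hclos (u, c), b)) <= size (entry (u, c, b)) + 1.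
Proof.
by have := size_enc_clos u c; have := size_enc_addr b; rewrite enc_entryE size_entry; klia.
Qed.

Lemma runs_emit_entry io e r B :
  40 * (size (entry e) + size io + size r) + 60 <= B ->
  runs emit_entry [:: io; entry e ++ r; [::]; [::]]
    [:: rev (enc_entry (hclos e.1, e.2)) ++ io; r; [::]; [::]] (size (entry e) * B + 10 * B) B.
Proof.
case: e => [[u c] b]; rewrite size_entry enc_entryE entry_cat => hB.
have hc := size_enc_clos u c; have hb := size_enc_addr b.
have hemit io' r' := @runs_emit_clos io' u c r' B.
move: (enc_clos _) hc hemit => C hc hemit.
have -> : rev (sLpar :: C ++ sSep :: enc_addr b ++ [:: sRpar]) ++ io =
    sRpar :: rev (enc_addr b) ++ sSep :: rev C ++ sLpar :: io.
  rewrite !(rev_cons, rev_cat) -!cats1 /= -!catA /=.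
  by rewrite ?cat_rcons -?catA /= -?catA /= -?catA /= ?cat_rcons.
apply: runs_weak (leqnn B).
  apply: runs_opseq; first by klia.
  st; apply: runs_seq.
    by apply: hemit; klia.
  apply: runs_opseq; first by klia.
  st; apply: runs_seq.
    by apply: runs_conv; rewrite /= !size_cat /= !size_rev /=; lia.
  apply: runT_runs (runT_op _ _ _ _ _) (leqnn _) _.
  by klia.
by lia.
Qed.

(** An emitted entry is at most one symbol longer than its source, which has at least three; the
    output grows by at most twice what is consumed, so the weight 2 keeps the space condition
    invariant. *)
Lemma runs_emit_heap io h B :
  80 * (2 * size (enc_aheap h) + size io) + 60 <= B ->
  runs emit_heap [:: io; enc_aheap h; [::]; [::]]
    [:: rev (enc_heap (hheap h)) ++ io; [::]; [::]; [::]] (size (enc_aheap h) * (12 * B) + 1) B.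
Proof.
elim: h io => [|e h IH] io hB; first by apply: runs_whF => //=; lia.
move: hB; rewrite enc_aheap_cons size_cat => hB.
have he : size (enc_entry (hclos e.1, e.2)) <= size (entry e) + 1.
  by case: (e) => [[u c] b]; exact: size_enc_entry.
have he' : 3 <= size (entry e) by case: (e) => [[u c] b]; rewrite size_entry; lia.
have -> : rev (enc_heap (hheap (e :: h))) ++ io =
    rev (enc_heap (hheap h)) ++ rev (enc_entry (hclos e.1, e.2)) ++ io.
  have -> : enc_heap (hheap (e :: h)) = enc_entry (hclos e.1, e.2) ++ enc_heap (hheap h) by [].
  by rewrite rev_cat -catA.
apply: runs_weak (leqnn B).
  eapply runs_whT; last 1 first.
  - by apply: IH; rewrite size_cat size_rev; lia.
  - by case: (entry e) he'.
  by apply: runs_emit_entry; lia.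
by rewrite mulnDl; have : 3 * B <= size (entry e) * B; [rewrite leq_mul2r he' orbT | lia].
Qed.

(** * The substitution machine *)

(* [Some u] stands for the value [tlam u] and [None] for an application; the variables
   of a closed term never occur outside its abstractions. *)
Fixpoint flat (s : term) : seq (option term) :=
  match s with
  | tvar _ => [::]
  | tapp s t => flat s ++ flat t ++ [:: None]
  | tlam s => [:: Some s]
  end.

Definition sstate := (seq (option term) * seq term)%type.

Inductive sstep : sstate -> sstate -> Prop :=
| SPush u P V : sstep (Some u :: P, V) (P, u :: V)
| SApp t s P V : sstep (None :: P, t :: s :: V) (flat (subst s 0 (tlam t)) ++ P, V).

Definition enc_flat (P : seq (option term)) : seq sym :=
  flatten [seq if o is Some u then enc (tlam u) else [:: sApp] | o <- P].

Lemma enc_flat_cat P Q : enc_flat (P ++ Q) = enc_flat P ++ enc_flat Q.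
Proof. by rewrite /enc_flat map_cat flatten_cat. Qed.

Lemma enc_flat_closed s : bound 0 s -> enc_flat (flat s) = enc s.
Proof.
elim: s => [n|s IHs t IHt|s _] //=; last by rewrite /enc_flat /= cats0.
by case/andP=> /IHs h1 /IHt h2; rewrite !enc_flat_cat h1 h2 enc_app.
Qed.

Lemma bound_weak s k l : k <= l -> bound k s -> bound l s.
Proof.
elim: s k l => [n|s IHs t IHt|s IH] k l kl /=; first by move/leq_trans; apply.
  by case/andP=> /(IHs _ _ kl)-> /(IHt _ _ kl)->.
by apply: IH; rewrite ltnS.
Qed.

Lemma bound_subst s k u : bound 0 u -> bound k.+1 s -> bound k (subst s k u).
Proof.
move=> hu; elim: s k => [n|s IHs t IHt|s IH] k /=.
- by rewrite ltnS; case: eqP => [_ _|nk h] /=; [exact: bound_weak hu | lia].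
- by case/andP=> /IHs-> /IHt->.
- exact: IH.
Qed.

Definition subst_stacks (x : sstate) : state :=
  [:: enc_flat x.1; enc_vals x.2; [::]; [::]; [::]; [::]].

Definition subst_step := If 0 (isx sLam) (ren [:: 0; 1; 3] (block sLam sRet)) beta.

Lemma runs_subst_machine x y X : sstep x y -> all (bound 1) x.2 ->
  tot (subst_stacks x) + tot (subst_stacks y) <= X ->
  runs subst_step (subst_stacks x) (subst_stacks y) ((X + 10) * (20 * X + 100)) (20 * X + 100).
Proof.
set B := 20 * X + 100.
case=> {x y}.
- move=> u P V _.
  rewrite -[subst_stacks (P, _)]/[:: enc_flat P; rev (enc (tlam u)) ++ enc_vals V; [::]; [::]; [::]; [::]].
  rewrite -[subst_stacks _]/[:: enc (tlam u) ++ enc_flat P; enc_vals V; [::]; [::]; [::]; [::]].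
  move: (enc_flat P) (enc_vals V) => p v hX; apply: (@runs_weak _ _ _ B B) => //; last by nia.
  have hu : size (enc (tlam u)) = (size (enc u)).+2 by rewrite enc_lam /= size_cat addn1.
  apply: runT_runs.
  + apply: runT_ifT; first by rewrite enc_lam.
    apply: (@runT_call [:: 0; 1; 3] _ _ [:: _; _; _]) => //.
    exact: runT_block_enc.
  + by move: hX; rewrite /B; klia.
  + by move: hX; rewrite /B; klia.
- move=> t s P V /and3P[bt bs _].
  have hc : bound 0 (subst s 0 (tlam t)) by apply: bound_subst.
  rewrite -[subst_stacks (None :: P, _)]/[:: sApp :: enc_flat P;
    rev (enc (tlam t)) ++ rev (enc (tlam s)) ++ enc_vals V; [::]; [::]; [::]; [::]].
  rewrite -[subst_stacks _]/[:: enc_flat (flat (subst s 0 (tlam t)) ++ P); enc_vals V;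
     [::]; [::]; [::]; [::]].
  rewrite enc_flat_cat enc_flat_closed //.
  move: (enc_flat P) (enc_vals V) => p v hX; apply: runs_weak.
  + apply: runs_ifF; first by [].
    apply: (runs_beta (X := X)) => //.
    by move: hX; klia.
  + by rewrite /B; nia.
  + by rewrite /B; lia.
Qed.

(** * Interleaving *)

(* Stacks: 0 input and output, 1 and 2 substitution machine, 3 to 8 heap machine, 9 to 12
   scratch, 13 and 14 sizes of the two machines, 15 nonempty while both are running. *)
Definition main_state (a : sstate) (b : hstate) (C1 C2 f : seq sym) : state :=
  [:: [::]; enc_flat a.1; enc_vals a.2;
      enc_tasks b.1.1; enc_addrs (map snd b.1.1); enc_vals (map fst b.1.2); enc_addrs (map snd b.1.2);
      rev (enc_aheap b.2); un (size b.2); [::]; [::]; [::]; [::]; C1; C2; f].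

Definition measure := While 0 nonempty (Push 1 sUn ;; Mov 0 2) ;; ren [:: 2; 0] mvall.

Lemma runT_measure a c : runT measure [:: a; un c; [::]] [:: a; un (size a + c); [::]] (5 * size a + 2).
Proof.
have count b d : runT (While 0 nonempty (Push 1 sUn ;; Mov 0 2)) [:: b; un c; d]
    [:: [::]; un (size b + c); rev b ++ d] (3 * size b + 1).
  elim: b c d => [|x b IH] c' d; first by apply: runT_whF.
  rewrite rev_cons cat_rcons /= addSnnS; apply: runT_le.
    eapply runT_whT; [by [] | | exact: (IH c'.+1)].
    exact/runT_opseq/runT_op.
  by lia.
apply: runT_le.
  eapply runT_seq; first exact: count.
  have h := runT_mvall (rev a) [::]; rewrite revK cats0 in h.
  by rewrite cats0; apply: (@runT_call [:: 2; 0] _ _ [:: _; _]) => //; exact: h.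
by klia.
Qed.

Definition cancel2 := While 0 nonempty (Pop 0 ;; Pop 1).

Lemma runT_cancel2 c1 c2 : runT cancel2 [:: un c1; un c2] [:: [::]; un (c2 - c1)] (3 * c1 + 1).
Proof.
elim: c1 c2 => [|c1 IH] c2; first by rewrite subn0; apply: runT_whF.
have -> : c2 - c1.+1 = c2.-1 - c1 by lia.
apply: runT_le; first (eapply runT_whT; [by [] | | exact: IH]).
  by apply: runT_opseq; st; rewrite -(_ : behead (un c2) = un c2.-1); [exact: runT_op | case: (c2)].
by lia.
Qed.

Definition compare := ren [:: 1; 13; 12] measure ;; ren [:: 2; 13; 12] measure ;;
  ren [:: 3; 14; 12] measure ;; ren [:: 4; 14; 12] measure ;; ren [:: 5; 14; 12] measure ;;
  ren [:: 6; 14; 12] measure ;; ren [:: 7; 14; 12] measure ;; ren [:: 8; 14; 12] measure ;;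
  ren [:: 13; 14] cancel2.

Lemma runT_compare a b f :
  runT compare (main_state a b [::] [::] f)
    (main_state a b [::] (un (tot (heap_stacks b) - tot (subst_stacks a))) f)
    (10 * (tot (heap_stacks b) + tot (subst_stacks a)) + 20).
Proof.
case: b => [[T W] h]; rewrite /main_state /=; apply: runT_le.
  do 8!(eapply runT_callseq; [by [] | exact: (runT_measure _ 0) || exact: runT_measure | st]).
  apply: (@runT_call [:: 13; 14] _ _ [:: _; _]) => //.
  have c c1 c2 d : d = c2 - c1 -> runT cancel2 [:: un c1; un c2] [:: [::]; un d] (3 * c1 + 1).
    by move->; exact: runT_cancel2.
  by apply: c; klia.
by klia.
Qed.

(** Stack 14 holds the excess of the heap machine over the substitution machine; if it is empty,
    ties included, the heap machine moves. *)
Definition choice := If 14 nonempty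
  (ren [:: 14] clr ;; ren [:: 1; 2; 9; 10; 11; 12] subst_step)
  (ren [:: 3; 4; 5; 6; 7; 8; 9; 10; 11; 12] heap_step).
Definition stop := If 1 nonempty (If 3 nonempty Skip (Pop 15)) (Pop 15).
Definition round := compare ;; choice ;; stop.
Definition main_loop := While 15 nonempty round.

Definition running (a : sstate) (b : hstate) : bool := ~~ nilp a.1 && ~~ nilp b.1.1.
Definition flag (a : sstate) (b : hstate) : seq sym := if running a b then [:: sUn] else [::].

Definition weight (a : sstate) (b : hstate) : nat := tot (heap_stacks b) + tot (subst_stacks a).

Lemma tot_main a b C1 C2 f :
  tot (main_state a b C1 C2 f) = weight a b + size C1 + size C2 + size f.
Proof. by case: b => [[T W] h]; rewrite /weight /=; lia. Qed.

Lemma tot_main0 a b : tot (main_state a b [::] [::] [:: sUn]) = (weight a b).+1.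
Proof. by rewrite tot_main !addn0 addn1. Qed.

Lemma enc_flat_nil P : nonempty (ohead (enc_flat P)) = ~~ nilp P.
Proof. by case: P => [|[u|] P] //; rewrite /enc_flat /= enc_lam. Qed.

Lemma enc_tasks_nil T : nonempty (ohead (enc_tasks T)) = ~~ nilp T.
Proof.
by case: T => [|[[|[n|u|] p] a] T] //; rewrite /enc_tasks /= /enc_items /= ?enc_lam.
Qed.

Lemma runT_stop a b : runT stop (main_state a b [::] [::] [:: sUn]) (main_state a b [::] [::] (flag a b)) 3.
Proof.
rewrite /flag /running; case ea: (nilp a.1); last case eb: (nilp b.1.1).
- apply: runT_le; first apply: runT_ifF; [by rewrite /top /get /= enc_flat_nil ea|exact: runT_op|by []].
- apply: runT_le; first apply: runT_ifT; [by rewrite /top /get /= enc_flat_nil ea| |].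
    by apply: runT_ifF; [rewrite /top /get /= enc_tasks_nil eb | exact: runT_op].
  by [].
- apply: runT_le; first apply: runT_ifT; [by rewrite /top /get /= enc_flat_nil ea| |].
    by apply: runT_ifT; [rewrite /top /get /= enc_tasks_nil eb | exact: runT_op].
  by [].
Qed.

Definition advance (a a' : sstate) (b b' : hstate) : Prop :=
  if tot (heap_stacks b) <= tot (subst_stacks a) then hstep b b' /\ a' = a else sstep a a' /\ b' = b.

Definition round_time (X : nat) := (X + 40) * (300 * X + 3000).

Lemma runs_round a a' b b' : advance a a' b b' -> all (bound 1) a.2 ->
  let X := weight a b + weight a' b' in
  runs round (main_state a b [::] [::] [:: sUn]) (main_state a' b' [::] [::] (flag a' b'))
    (round_time X) (300 * X + 3000).
Proof.
move=> hn ha X; set B := 300 * X + 3000.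
have hab : weight a b <= X by rewrite /X; lia.
have hab' : weight a' b' <= X by rewrite /X; lia.
have h1 : runs compare (main_state a b [::] [::] [:: sUn])
    (main_state a b [::] (un (tot (heap_stacks b) - tot (subst_stacks a))) [:: sUn]) B B.
  apply: runT_runs (runT_compare a b _) _ _; first by move: hab; rewrite /weight /B; lia.
  by rewrite tot_main0; move: hab; rewrite /weight /B; lia.
have h3 : runs stop (main_state a' b' [::] [::] [:: sUn]) (main_state a' b' [::] [::] (flag a' b')) 3 B.
  by apply: runT_runs (runT_stop a' b') _ _; rewrite // tot_main0 /B; lia.
suff h2 : runs choice
    (main_state a b [::] (un (tot (heap_stacks b) - tot (subst_stacks a))) [:: sUn])
    (main_state a' b' [::] [::] [:: sUn]) ((X + 20) * (200 * X + 2000) + 2 * X + 100) B.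
  apply: runs_weak (runs_seq h1 (runs_seq h2 h3)) _ _ => //; rewrite /round_time -/B.
  have -> : X + 40 = (X + 20) + 20 by lia.
  have : (X + 20) * (200 * X + 2000) <= (X + 20) * B by apply: leq_mul => //; rewrite /B; lia.
  rewrite (mulnDl (X + 20) 20 B); move: (_ * (200 * X + _)) ((X + 20) * B) => p q hpq.
  by rewrite /B; lia.
move: hn; rewrite /advance; case: leqP => hle [hs e].
  subst a'; have -> : tot (heap_stacks b) - tot (subst_stacks a) = 0 by lia.
  have hX : tot (heap_stacks b) + tot (heap_stacks b') <= X by rewrite /X /weight; lia.
  have := runs_heap_step hs hX; move: (tot_main0 a b).
  case: (b) (b') hab => [[T W] h] [[T' W'] h'] hab ht hr.
  apply: runs_weak.
  + apply: runs_ifF; first by [].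
    exact: (@runs_call [:: 3; 4; 5; 6; 7; 8; 9; 10; 11; 12] _ (main_state a (T, W, h) [::] [::] [:: sUn]) _ _ _ isT hr).
  + by lia.
  + by apply: leq_trans (leq_add (eq_leq ht) (leqnn _)) _; rewrite /B; lia.
subst b'; have [d ed] : exists d, tot (heap_stacks b) - tot (subst_stacks a) = d.+1.
  by exists (tot (heap_stacks b) - tot (subst_stacks a)).-1; lia.
have hd : d < X by rewrite -ed /X /weight; lia.
have hX : tot (subst_stacks a) + tot (subst_stacks a') <= X by rewrite /X /weight; lia.
have := runs_subst_machine hs ha hX; rewrite ed => hr.
move: (tot_main0 a b) (tot_main a b [::] (un d.+1) [:: sUn]) => ht ht'.
apply: (@runs_weak _ _ _ _ B).
+ apply: runs_ifT; first by [].
  apply: (runs_seq (S1 := main_state a b [::] [::] [:: sUn])); last first.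
    apply: runs_weak (leqnn _) _.
      exact: (@runs_call [:: 1; 2; 9; 10; 11; 12] _ (main_state a b [::] [::] [:: sUn]) _ _ _ isT hr).
    by apply: leq_trans (leq_add (eq_leq ht) (leqnn _)) _; rewrite /B; lia.
  apply: runT_runs (leqnn _) _.
    apply: (@runT_call [:: 14] clr (main_state a b [::] (un d.+1) [:: sUn]) [:: [::]]) => //.
    exact: runT_clr.
  apply: leq_trans (leq_add (eq_leq ht') (leqnn _)) _.
  by rewrite -[size [::]]/0 -[size [:: sUn]]/1 -[get _ _]/(un d.+1) !size_un /B; lia.
+ by rewrite -[get _ _]/(un d.+1) size_un; nia.
+ by [].
Qed.

Lemma round_time_mono X Y : X <= Y -> round_time X <= round_time Y.
Proof. by move=> h; apply: leq_mul; lia. Qed.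

(** The same weight is bounded twice: [Xt] enters only the time and [Xs] only the space. This lets
    the time depend on [Time xs] while the space does not. *)
Lemma runs_main_loop (I : nat -> sstate -> hstate -> Prop) Xt Xs :
  (forall m a b, I m a b -> [/\ all (bound 1) a.2, weight a b <= Xt & weight a b <= Xs]) ->
  (forall m a b, I m a b -> running a b ->
     exists m' (a' : sstate) (b' : hstate), [/\ m' < m, I m' a' b' & advance a a' b b']) ->
  forall m a b, I m a b -> exists m' a' b', [/\ I m' a' b', ~~ running a' b' &
    runs main_loop (main_state a b [::] [::] (flag a b)) (main_state a' b' [::] [::] [::])
      (m.+1 * (round_time (2 * Xt)).+1) (600 * Xs + 3000)].
Proof.
move=> hI hn m; elim/ltn_ind: m => m IH a b hab; rewrite /flag.
have [_ ht hs] := hI _ _ _ hab.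
case r: (running a b); last first.
  exists m, a, b; rewrite r; split=> //; apply: (@runs_weak _ _ _ 1 (600 * Xs + 3000)) => //.
  by apply: runs_whF => //; rewrite tot_main -[size [::]]/0; lia.
have [m1 [a1 [b1 [hm h1 hnx]]]] := hn _ _ _ hab r.
have [_ ht1 hs1] := hI _ _ _ h1; have [hb _ _] := hI _ _ _ hab.
have [m' [a' [b' [h' r' hr]]]] := IH _ hm _ _ h1.
exists m', a', b'; split=> //.
have hX : weight a b + weight a1 b1 <= 2 * Xt by lia.
have hround := runs_round hnx hb.
apply: runs_weak.
- apply: runs_whT; [by [] | | exact: hr].
  by apply: runs_weak hround (leqnn _) _; lia.
- have := round_time_mono hX; move: (round_time (weight _ _ + _)) (round_time (2 * Xt)) => p q hpq.
  have : m1.+1 * q.+1 <= m * q.+1 by apply: leq_mul.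
  by rewrite (mulSn m); lia.
- by [].
Qed.

(** * Loading the input and emitting the result *)

Definition load := ren [:: 0; 1] mvall ;; Push 3 sRet ;; ren [:: 1; 3; 9] dupall ;; Push 4 sSep ;;
  Push 15 sUn.

Definition start_s (s : term) : sstate := (flat s, [::]).
Definition start_h (s : term) : hstate := ([:: (items s, 0)], [::], [::]).

Lemma flag_start s : closedL s -> flag (start_s s) (start_h s) = [:: sUn].
Proof.
rewrite /flag /running /= andbT; suff h : bound 0 s -> ~~ nilp (flat s) by move/h->.
elim: s => //= s IHs t IHt /andP[/IHs hs _].
by case: (flat s) hs.
Qed.

Lemma runT_load s : closedL s ->
  runT load (rev (enc s) :: nseq 15 [::])
    (main_state (start_s s) (start_h s) [::] [::] (flag (start_s s) (start_h s)))
    (7 * size (enc s) + 10).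
Proof.
move=> hs; rewrite flag_start //.
have -> : main_state (start_s s) (start_h s) [::] [::] [:: sUn] =
  [:: [::]; enc s; [::]; enc s ++ [:: sRet]; [:: sSep]; [::]; [::]; [::]; [::]; [::]; [::]; [::]; [::];
     [::]; [::]; [:: sUn]].
  by rewrite /main_state /= enc_flat_closed // /enc_tasks /= enc_items_term cats0.
have h := runT_mvall (rev (enc s)) [::]; rewrite revK cats0 size_rev in h.
apply: runT_le.
  eapply runT_callseq; [by [] | exact: h |].
  apply: runT_opseq; st.
  eapply runT_callseq; [by [] | exact: runT_dupall |].
  by apply: runT_opseq; apply: runT_op.
by klia.
Qed.

Definition finish_subst := Push 9 sSep ;; Push 9 sSep ;; ren [:: 2; 9; 10] (block sRet sLam).
Definition finish_heap := ren [:: 7; 9] mvall ;; ren [:: 0; 9; 10; 11] emit_heap ;; Push 9 sSep ;;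
  ren [:: 6; 9] (mvw (isx sUn)) ;; Push 9 sSep ;; ren [:: 5; 9; 10] (block sRet sLam).
Definition finish := If 1 nonempty finish_heap finish_subst ;; Push 0 sSep ;;
  ren [:: 0; 9; 10; 11] emit_clos.

(** The test on [a.1] agrees with the one made by [finish]. A value of the substitution machine is
    closed, so address 0 in the empty heap makes it a closure. *)
Definition final (a : sstate) (b : hstate) (h : aheap) (g : aclos) : Prop :=
  if nilp a.1 then a.2 = [:: g.1] /\ g.2 = 0 /\ h = [::]
  else b.1 = ([::], [:: g]) /\ h = b.2.

Lemma size_enc_heap h : size (enc_heap (hheap h)) <= 2 * size (enc_aheap h).
Proof.
elim: h => [|[[u c] b] h IH] //; rewrite enc_aheap_cons.
have -> : enc_heap (hheap ((u, c, b) :: h)) = enc_entry (hclos (u, c), b) ++ enc_heap (hheap h) by [].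
by have := size_enc_entry u c b; rewrite !size_cat size_entry; lia.
Qed.

Lemma runT_finish_subst P V T TA W WA H K u :
  runT finish_subst
    [:: [::]; P; rev (enc (tlam u)) ++ V; T; TA; W; WA; H; K; [::]; [::]; [::]; [::]; [::]; [::]; [::]]
    [:: [::]; P; V; T; TA; W; WA; H; K; enc (tlam u) ++ [:: sSep; sSep];
       [::]; [::]; [::]; [::]; [::]; [::]] (5 * size (enc (tlam u)) + 11).
Proof.
apply: runT_le.
  apply: runT_opseq; st; apply: runT_opseq; st.
  by apply: (@runT_call [:: 2; 9; 10] _ _ [:: _; _; _]); [|exact: runT_block_rev].
by rewrite enc_lam /= size_cat; lia.
Qed.

Lemma runs_finish_heap P V T TA W WA h K u c B :
  200 * (size P + size V + size T + size TA + size (enc (tlam u)) + size W + c + size WA +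
    size (enc_aheap h) + size K) + 500 <= B ->
  runs finish_heap
    [:: [::]; P; V; T; TA; rev (enc (tlam u)) ++ W; un c ++ sSep :: WA; rev (enc_aheap h); K;
       [::]; [::]; [::]; [::]; [::]; [::]; [::]]
    [:: rev (enc_heap (hheap h)); P; V; T; TA; W; sSep :: WA; [::]; K;
       enc (tlam u) ++ sSep :: un c ++ [:: sSep]; [::]; [::]; [::]; [::]; [::]; [::]]
    (size (enc_aheap h) * (12 * B) + B) B.
Proof.
move=> hB; have hh := size_enc_heap h.
have hu : size (enc (tlam u)) = (size (enc u)).+2 by rewrite enc_lam /= size_cat addn1.
(* [runs_call] adds the stacks of the caller to the space of the call, so their share is set aside
   beforehand. *)
have he := @runs_emit_heap [::] h (B - 40 * (size P + size V + size T + size TA + size (enc (tlam u)) + size W + c + size WA + size (enc_aheap h) + size K)).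
apply: runs_weak (leqnn B).
  apply: runs_callseq; [by [] | exact: runT_mvall | |].
    by klia.
  rewrite revK cats0 /=.
  apply: runs_seq.
    apply: runs_weak (leqnn _) _.
      apply: (@runs_call [:: 0; 9; 10; 11] _ _ [:: _; _; _; _]) => //.
      by apply: he; rewrite /=; lia.
    by klia.
  rewrite cats0; apply: runs_opseq; first by klia.
  st; apply: runs_callseq; [by [] | by apply: runT_mvw; first exact: all_un | |].
    by klia.
  rewrite rev_un; apply: runs_opseq; first by klia.
  st; apply: runT_runs (leqnn _) _.
    by apply: (@runT_call [:: 5; 9; 10] _ _ [:: _; _; _]); [|exact: runT_block_rev].
  by klia.
klia.
Qed.

Lemma runs_finish_tail io X P V T TA W WA H K u c B :
  X = [:: io; P; V; T; TA; W; WA; H; K; enc (tlam u) ++ sSep :: un c ++ [:: sSep];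
       [::]; [::]; [::]; [::]; [::]; [::]] ->
  100 * tot X + 200 <= B ->
  runs (Push 0 sSep ;; ren [:: 0; 9; 10; 11] emit_clos) X
    [:: rev (enc_clos (hclos (u, c))) ++ sSep :: io; P; V; T; TA; W; WA; H; K; [::];
       [::]; [::]; [::]; [::]; [::]; [::]] ((c + 4) * B) B.
Proof.
move=> -> hB; have he := @runs_emit_clos (sSep :: io) u c [::] (50 * tot
  [:: io; P; V; T; TA; W; WA; H; K; enc (tlam u) ++ sSep :: un c ++ [:: sSep];
       [::]; [::]; [::]; [::]; [::]; [::]] + 150).
apply: runs_weak (leqnn B).
  apply: runs_opseq; first lia.
  st; apply: runs_weak (leqnn _) _.
    apply: (@runs_call [:: 0; 9; 10; 11] _ _ [:: _; _; _; _]) => //.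
    by apply: he; klia.
  by move: hB; klia.
by move: hB; set t := tot _ => hB; nia.
Qed.

Lemma runs_finish a b h u c B : final a b h (u, c) -> 1000 * weight a b + 1000 <= B ->
  exists2 S, get S 0 = rev (enc_output (hheap h) (hclos (u, c))) &
    runs finish (main_state a b [::] [::] [::]) S (20 * B * B) B.
Proof.
have -> : rev (enc_output (hheap h) (hclos (u, c))) =
    rev (enc_clos (hclos (u, c))) ++ sSep :: rev (enc_heap (hheap h)).
  by rewrite /enc_output rev_cat rev_cons cat_rcons.
case: a b => P V [[T W] h']; rewrite /final.
case eP: (nilp (P, V).1) => /=.
  case: P eP => // _ [-> [-> ->]] hB.
  have ht := tot_main ([::], [:: u]) (T, W, h') [::] [::] [::].
  move: ht hB; move: (weight _ _) => w; rewrite /main_state /= => ht hB.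
  rewrite /enc_vals /= in ht *.
  eexists; last first.
    apply: runs_weak (leqnn B).
      apply: runs_seq.
        apply: runs_ifF; first by [].
        apply: runT_runs (leqnn _) _; first exact: runT_finish_subst.
        by move: ht; klia.
      apply: (@runs_finish_tail _ _ _ _ _ _ _ _ _ _ u 0); first by [].
      by move: ht; klia.
    have hBB : 1000 * B <= B * B by apply: leq_mul; lia.
    by rewrite -mulnA; move: ht; klia.
  by rewrite /get.
case=> [[-> ->]] -> hB.
have ht := tot_main (P, V) ([::], [:: (u, c)], h') [::] [::] [::].
have hh := size_enc_heap h'.
move: ht hB; move: (weight _ _) => w; rewrite /main_state /= => ht hB.
rewrite /enc_vals /enc_addrs /= in ht *.
eexists; last first.
  apply: runs_weak (leqnn B).
    apply: runs_seq.
      apply: runs_ifT; first by rewrite /top /get /= enc_flat_nil eP.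
      rewrite -catA /=; apply: runs_finish_heap.
      by move: ht; klia.
    apply: runs_finish_tail; first by [].
    by move: ht; klia.
  have hBB : 1000 * B <= B * B by apply: leq_mul; lia.
  have hc : (c + 4) * B <= B * B by apply: leq_mul; move: ht; klia.
  have hs : size (enc_aheap h') * B <= B * B by apply: leq_mul; move: ht; klia.
  rewrite -mulnA; lia.
by rewrite /get.
Qed.

(** * Correctness of the substitution machine *)

Lemma step_abs s t : is_abs s -> ~ step s t.
Proof. by case: s => // s _ h; inversion h. Qed.

Lemma step_det s t1 t2 : step s t1 -> step s t2 -> t1 = t2.
Proof.
have lam u v : step (tlam u) v -> False by move/step_abs; apply.
move=> h; elim: h t2 => {s t1} [s t|s s' t hs IH|s t t' ht IH] t2 h2; inversion h2; subst => //;
  try (by exfalso; eauto); by congr tapp; apply: IH.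
Qed.

(** Reads a state back by postfix evaluation on the operand stack [st]. A missing operand gives
    [[::]], so [dec st P = [:: x]] says that the state is well formed and represents [x]. *)
Fixpoint dec (st : seq term) (P : seq (option term)) : seq term :=
  match P with
  | [::] => st
  | Some u :: P' => dec (tlam u :: st) P'
  | None :: P' => if st is b :: a :: st' then dec (tapp a b :: st') P' else [::]
  end.

Lemma dec_flat s st P : bound 0 s -> dec st (flat s ++ P) = dec (s :: st) P.
Proof.
elim: s st P => [n|s IHs t IHt|s _] st P //= /andP[hs ht].
by rewrite -catA IHs // -catA IHt.
Qed.

(** Below [r] there are only values, and these end up on its left in the term, so call-by-value
    order allows a step at [r]; [st] holds what ends up on its right. *)
Lemma dec_step st V P r r' x : step r r' -> dec (st ++ r :: map tlam V) P = [:: x] ->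
  exists2 x', dec (st ++ r' :: map tlam V) P = [:: x'] & step x x'.
Proof.
elim: P st V r r' => [|[u|] P IH] st V r r' h /=.
- case: st => [|y [|z st]] //=; case: V => // -[<-]; by exists r'.
- by move=> e; apply: (IH (tlam u :: st)) e.
case: st => [|b [|a st]] /=.
- case: V => [|v V] //=; apply: (IH [::]); exact: stepAppR.
- apply: (IH [::]); exact: stepAppL.
- by apply: (IH (tapp a b :: st)).
Qed.

(** Applications outside abstractions. A step removes at most one and an abstraction has none, so
    they are at most the steps left; together with [dec_length] this bounds the value stack. *)
Fixpoint napps (s : term) : nat := if s is tapp s t then (napps s + napps t).+1 else 0.

Lemma napps_step s t : step s t -> napps s <= (napps t).+1.
Proof. by elim=> {s t} //= *; lia. Qed.

Lemma napps_chain s xs : chain s xs -> is_abs (last s xs) -> napps s <= size xs.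
Proof.
elim: xs s => [|y xs IH] s /=; first by case: s.
by case=> /napps_step h1 h2 /(IH _ h2) h3; lia.
Qed.

Definition isome (o : option term) := isSome o.
Definition osize (o : option term) := if o is Some u then lsize (tlam u) else 1.

Lemma dec_napps st P x : dec st P = [:: x] ->
  sumn (map napps st) + count (predC isome) P = napps x.
Proof.
elim: P st => [|[u|] P IH] st /=; first by move=> ->; rewrite /= !addn0.
  by move/IH => /= <-.
by case: st => [|b [|a st]] //= /IH /= <-; lia.
Qed.

Lemma dec_length st P x : dec st P = [:: x] ->
  size st + count isome P = (count (predC isome) P).+1.
Proof.
elim: P st => [|[u|] P IH] st /=; first by move=> ->.
  by move/IH => /= h; lia.
by case: st => [|b [|a st]] //= /IH /= h; lia.
Qed.

Lemma dec_size st P x : dec st P = [:: x] ->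
  sumn (map lsize st) + sumn (map osize P) = lsize x.
Proof.
elim: P st => [|[u|] P IH] st /=; first by move=> ->; rewrite /= !addn0.
  by move/IH => /= <-; lia.
by case: st => [|b [|a st]] //= /IH /= <-; lia.
Qed.

Lemma lsize_gt0 s : 0 < lsize s. Proof. by case: s. Qed.

Lemma lsize_subst s k u : lsize (subst s k u) <= lsize s * lsize u.
Proof.
have hu := lsize_gt0 u.
by elim: s k => [n|s IHs t IHt|s IH] k /=;
   [case: eqP => _ /=; nia | have := IHs k; have := IHt k; nia | have := IH k.+1; nia].
Qed.

Lemma lsize_step s t : step s t -> lsize t <= lsize s * lsize s.
Proof.
elim=> {s t} [s t|s s' t _ IH|s t t' _ IH] /=.
- by have := lsize_subst s 0 (tlam t) => /=; nia.
- by nia.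
- by nia.
Qed.

Definition oclosed (o : option term) : bool := if o is Some u then bound 1 u else true.

(* [a] decomposes a term with [n] reduction steps left to the normal form [t], all terms
   on the way having size at most [S]. *)
Definition sinv (S : nat) (t : term) (n : nat) (a : sstate) : Prop :=
  exists x xs, [/\ dec (map tlam a.2) a.1 = [:: x], chain x xs,
    last x xs = t /\ is_abs t, all (fun y => lsize y <= S) (x :: xs)
    & size xs = n /\ all (bound 1) a.2 && all oclosed a.1].

Lemma sinv_len S t n a : sinv S t n a -> size a.2 <= n.+1.
Proof.
case=> x [xs [hd hc [ht ha] _ [<- _]]]; have := dec_length hd; have := dec_napps hd.
by rewrite -ht in ha; have := napps_chain hc ha; rewrite size_map; lia.
Qed.

Lemma flat_closed s : bound 0 s -> all oclosed (flat s).
Proof.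
by elim: s => [n|s IHs t IHt|s _] //= => [/andP[/IHs hs /IHt ht]|->//]; rewrite !all_cat hs ht.
Qed.

Lemma sinv_prog S t n a : sinv S t n a -> ~~ nilp a.1 -> exists a', sstep a a'.
Proof.
case: a => [[|[u|] P] V] // [x [xs [/= hd _ _ _ _]]] _; first by eexists; exact: SPush.
by case: V hd => [|v [|w V]] //= _; eexists; exact: SApp.
Qed.

Lemma dec_beta s v P V x : bound 1 s -> bound 1 v ->
  dec (tapp (tlam s) (tlam v) :: map tlam V) P = [:: x] ->
  exists2 x', dec (map tlam V) (flat (subst s 0 (tlam v)) ++ P) = [:: x'] & step x x'.
Proof.
move=> bs bv hd; rewrite dec_flat; last by apply: bound_subst.
exact: (@dec_step [::]) (stepBeta s v) hd.
Qed.

(** A push does not change the represented term. A contraction performs one reduction, which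
    determinism identifies with the next term of the given sequence. *)
Lemma sinv_step S t n a a' : sinv S t n a -> sstep a a' ->
  exists2 n', sinv S t n' a' &
    ((n' = n /\ size a'.2 = (size a.2).+1) \/ (n = n'.+1 /\ size a.2 = (size a'.2).+2)).
Proof.
move=> + h; case: h => {a a'} [u P V|v s P V] [x [xs [/= hd hc ht hS [hn hb]]]].
  exists n; last by left.
  by exists x, xs; split=> //=; split=> //; move: hb => /and3P[-> -> ->].
case/andP: hb => /and3P[bv bs bV] bP.
have [x' hd' hx] := dec_beta bs bv hd.
case: xs hc ht hn hS => [|y xs] /=.
  by move=> _ [<- hx'] _ _; case: (step_abs hx' hx).
case=> hy hc ht <- /and3P[_ hy' hxs]; have ey := step_det hx hy; subst y.
exists (size xs); last by right.
exists x', xs; split=> //=; first by rewrite hy' hxs.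
by split=> //; rewrite bV all_cat flat_closed //; apply: bound_subst.
Qed.

(** * The heap machine simulates the substitution machine *)

(** Read from its end, a program is a prefix code: the last command determines the constructor.
    Hence the generalisation to reversed programs with arbitrary remainders. *)
Lemma gamma_inj : injective gamma.
Proof.
suff H s t r r' : rev (gamma s) ++ r = rev (gamma t) ++ r' -> s = t /\ r = r'.
  by move=> s t e; case: (H s t [::] [::]); rewrite ?e.
elim: s t r r' => [n|s1 IH1 s2 IH2|s IH] [m|t1 t2|t] r r' /=;
  rewrite ?rev_cons ?rev_cat ?rev_cons -?cats1 /= -?catA //=.
- by case=> -> ->.
- by case=> /IH2[-> /IH1[-> ->]].
- by case=> /IH[-> [->]].
Qed.

Lemma heap_get_cat H E a e : heap_get H a = Some e -> heap_get (H ++ E) a = Some e.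
Proof.
rewrite /heap_get; case: a => [|a] //=.
by elim: H a => [|x H IH] [|a] //=; apply: IH.
Qed.

Lemma lookup_cat H E a n g : lookup H a n = Some g -> lookup (H ++ E) a n = Some g.
Proof.
elim: n a => [|n IH] a /=; case e: (heap_get H a) => [[g' b]|] //=.
  by rewrite (heap_get_cat _ e).
by rewrite (heap_get_cat _ e); apply: IH.
Qed.

Lemma unfolds_cat H E s a k s' : unfolds H s a k s' -> unfolds (H ++ E) s a k s'.
Proof.
elim=> {s a k s'}.
- by move=> *; apply: unf_bound.
- by move=> n a k P b u s' h1 h2 h3 _ h; apply: (unf_free h1 (lookup_cat E h2) h3 h).
- by move=> *; apply: unf_lam.
- by move=> *; apply: unf_app.
Qed.

Lemma unfolds_bound H s a k s' : unfolds H s a k s' -> bound k s'.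
Proof.
elim=> {s a k s'} //=.
- by move=> n a k P b u s' _ _ _ _; apply: bound_weak.
- by move=> s t a k s' t' _ -> _ ->.
Qed.

Lemma unfolds_closed H s a k : bound k s -> unfolds H s a k s.
Proof.
elim: s k => [n|s IHs t IHt|s IH] k /=; first exact: unf_bound.
  by case/andP=> /IHs h1 /IHt h2; apply: unf_app.
by move/IH/unf_lam.
Qed.

Lemma subst_closed s k u : bound k s -> subst s k u = s.
Proof.
elim: s k => [n|s IHs t IHt|s IH] k /=; first by move=> h; rewrite ltn_eqF.
  by case/andP=> /IHs-> /IHt->.
by move/IH->.
Qed.

Lemma lookup_new H g b n :
  lookup (rcons H (g, b)) (size H).+1 n =
  if n is n'.+1 then lookup (rcons H (g, b)) b n' else Some g.
Proof.
have e : heap_get (rcons H (g, b)) (size H).+1 = Some (g, b).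
  by rewrite /heap_get /=; elim: H => //=.
by case: n => [|n]; rewrite /= e.
Qed.

(** An argument in front of the environment acts as a substitution: index [k], bound before, becomes
    free and finds the new entry, while a larger index passes over that entry and is looked up from
    [a] as before. *)
Lemma unfolds_subst H s a k s' P b t t' :
  unfolds H s a k.+1 s' -> prog_rep P t -> unfolds H t b 0 t' ->
  unfolds (rcons H ((P, b), a)) s (size H).+1 k (subst s' k t').
Proof.
move=> h hP ht; move e: k.+1 h => l h.
elim: h k e => {s a l s'} [n a l hn|n a l P' b' u s' hl hk hP' hu _|s a l s' _ IH|s1 s2 a l s1' s2' _ IH1 _ IH2] k e;
  subst l => /=.
- case: eqP => [->|nk]; last by apply: unf_bound; lia.
  apply: (@unf_free _ k _ k P b t) => //; first by rewrite subnn lookup_new.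
  by rewrite -cats1; apply: unfolds_cat.
(* What was unfolded from the heap is closed, so the substitution leaves it unchanged. *)
- rewrite subst_closed; last by apply: bound_weak (unfolds_bound hu).
  apply: (@unf_free _ n _ k P' b' u) => //; first exact: ltnW.
    have -> : n - k = (n - k.+1).+1 by lia.
    by rewrite lookup_new -cats1; apply: lookup_cat.
  by rewrite -cats1; apply: unfolds_cat.
- by apply: unf_lam; apply: IH.
- by apply: unf_app; [apply: IH1 | apply: IH2].
Qed.

(** A variable of the heap machine corresponds to the value that the substitution machine has
    already put in its place. *)
Definition item_sim (H : heap) (ia : item * nat) (o : option term) : Prop :=
  match ia.1, o with
  | IVar n, Some v => unfolds H (tvar n) ia.2 0 (tlam v)
  | ILam u, Some v => unfolds H (tlam u) ia.2 0 (tlam v)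
  | IApp, None => True
  | _, _ => False
  end.
Definition clos_sim (H : heap) (g : aclos) (v : term) : Prop := unfolds H (tlam g.1) g.2 0 (tlam v).
(** Joined, the pending tasks form the single program of the substitution machine, each item keeping
    its own address; exhausted tasks vanish, so [HRet] corresponds to no step. *)
Definition flat_tasks (T : seq (seq item * nat)) : seq (item * nat) :=
  flatten [seq [seq (i, x.2) | i <- x.1] | x <- T].

Definition sim (a : sstate) (b : hstate) : Prop :=
  List.Forall2 (item_sim (hheap b.2)) (flat_tasks b.1.1) a.1 /\
  List.Forall2 (clos_sim (hheap b.2)) b.1.2 a.2.

Lemma Forall2_mono (A B : Type) (R1 R2 : A -> B -> Prop) s t :
  (forall x y, R1 x y -> R2 x y) -> List.Forall2 R1 s t -> List.Forall2 R2 s t.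
Proof. by move=> h; elim=> {s t} *; constructor; auto. Qed.

Lemma item_sim_cat H E ia o : item_sim H ia o -> item_sim (H ++ E) ia o.
Proof. by case: ia o => [[n|u|] a] [v|] //; apply: unfolds_cat. Qed.

Lemma items_sim H s a r : unfolds H s a 0 r ->
  List.Forall2 (item_sim H) [seq (i, a) | i <- items s] (flat r).
Proof.
move e: 0 => k h; elim: h e => {s a k r} [n a k hn|n a k P b u s' hk hl hP hu _|s a k s' h _|s1 s2 a k s1' s2' _ IH1 _ IH2] e;
  subst k => //=.
- have [v ev] : exists v, s' = tlam v.
    by case: hP hu => u' [_ ->] hu; inversion hu; eexists.
  by subst s'; constructor; [exact: unf_free hk hl hP hu | constructor].
- by constructor; [exact: unf_lam | constructor].
- rewrite !map_cat; apply: List.Forall2_app; first exact: IH1.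
  by apply: List.Forall2_app; [exact: IH2 | constructor; [|constructor]].
Qed.

Lemma lookup_alook h a n : lookup (hheap h) a n = omap hclos (alook h a n).
Proof.
have e c : heap_get (hheap h) c = omap (fun e => (hclos e.1, e.2)) (aget h c).
  rewrite /heap_get /aget; case: c => [|c] //=.
  by elim: h c => [|x h IH] [|c] //=; apply: IH.
by elim: n a => [|n IH] a /=; rewrite e; case: (aget h a) => [[g b]|] //=.
Qed.

Lemma hheap_rcons h e : hheap (rcons h e) = rcons (hheap h) (hclos e.1, e.2).
Proof. by rewrite /hheap map_rcons. Qed.

Lemma flat_tasks_cons p a T : flat_tasks ((p, a) :: T) = [seq (i, a) | i <- p] ++ flat_tasks T.
Proof. by []. Qed.

Lemma sim_step S t n a b : sinv S t n a -> sim a b -> ~~ nilp b.1.1 -> exists2 b', hstep b b' &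
  ((sim a b' /\ (size b.1.1 = (size b'.1.1).+1 /\ b'.2 = b.2)) \/ exists2 a', sstep a a' & sim a' b').
Proof.
case: a b => P V [[[|[p x] T] W] h] // hinv [/= hT hW] _.
case: p hT => [|i p] hT.
  by eexists; [exact: HRet | left].
inversion hT as [|ia o l P' hi hT' e1 e2]; subst.
case: i hi hT => [m|u|] hi hT.
- case: o hi hT hinv => [v|] // hi hT hinv; rewrite /item_sim /= in hi.
  inversion hi as [|? ? ? Pg c u ? _ hl hP hu| |]; subst => //.
  move: hl; rewrite subn0 lookup_alook; case el: (alook h x m) => [[w d]|] //= [ew ed]; subst Pg d.
  case: hP hu => u' [/gamma_inj <- ->] hu.
  eexists; first exact: (HVar _ _ _ el).
  by right; eexists; [exact: SPush | split=> //; constructor].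
- case: o hi hT hinv => [v|] // hi hT hinv.
  eexists; first exact: HLam.
  by right; eexists; [exact: SPush | split=> //; constructor].
- case: o hi hT hinv => [v|] // _ hT hinv.
  (* The simulated machine is not stuck, so the application finds its two values in the heap machine
     as well. *)
  have [a' ha'] := sinv_prog hinv isT.
  inversion ha' as [|t' s' P0 V0]; subst.
  inversion hW as [|[t0 ct] ? W0 ? ht hW0]; subst.
  inversion hW0 as [|[s0 cs] ? W1 ? hs hW1]; subst.
  eexists; first exact: HApp.
  right; eexists; first exact: SApp.
  rewrite /clos_sim /= in ht hs; inversion hs as [| |? ? ? ? hs'|]; subst.
  have hh : hheap (rcons h ((t0, ct), cs)) = rcons (hheap h) (gamma t0, ct, cs) by rewrite hheap_rcons.
  have hp : prog_rep (gamma t0) (tlam t0) by exists t0.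
  have := unfolds_subst hs' hp ht; rewrite size_map -hh => /items_sim hi.
  split; rewrite /=; last first.
    by apply: Forall2_mono hW1 => g v; rewrite hh -cats1; apply: unfolds_cat.
  rewrite flat_tasks_cons; apply: List.Forall2_app => //.
  by apply: Forall2_mono hT' => ia o; rewrite hh -cats1; apply: item_sim_cat.
Qed.

(** * Size bounds *)

Lemma size_enc_le s : lsize s <= size (enc s) <= 2 * lsize s.
Proof.
by elim: s => [n|s IHs t IHt|s IH];
  rewrite ?enc_var ?enc_app ?enc_lam /= ?size_cat /= ?size_un; lia.
Qed.

Lemma size_subst_stacks a x : dec (map tlam a.2) a.1 = [:: x] ->
  lsize x <= tot (subst_stacks a) <= 2 * lsize x.
Proof.
case: a => P V /= /dec_size <-; rewrite !addn0.
have hP : sumn (map osize P) <= size (enc_flat P) <= 2 * sumn (map osize P).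
  elim: P => [|[u|] P IH] //.
    have -> : enc_flat (Some u :: P) = enc (tlam u) ++ enc_flat P by [].
    by have := size_enc_le (tlam u); rewrite size_cat /=; lia.
  have -> : enc_flat (None :: P) = sApp :: enc_flat P by [].
  by rewrite /=; lia.
have hV : sumn (map lsize (map tlam V)) <= size (enc_vals V) <= 2 * sumn (map lsize (map tlam V)).
  elim: V => [|u V IH] //.
  have -> : enc_vals (u :: V) = rev (enc (tlam u)) ++ enc_vals V by [].
  by have := size_enc_le (tlam u); rewrite size_cat size_rev /=; lia.
lia.
Qed.

Lemma size_sstep S t n a a' : sinv S t n a -> sstep a a' ->
  tot (subst_stacks a') <= 2 * (tot (subst_stacks a) * tot (subst_stacks a)).
Proof.
case=> x [xs [hd _ _ _ [_ hb]]] hs.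
have [x' hd' hx] : exists2 x', dec (map tlam a'.2) a'.1 = [:: x'] & lsize x' <= lsize x * lsize x.
  case: hs hd hb => {a a'} [u P V|v s P V] /= hd hb.
    by exists x => //; have := lsize_gt0 x; nia.
  case/andP: hb => /and3P[bv bs _] _; have [x' h /lsize_step hx] := dec_beta bs bv hd.
  by exists x'.
have := size_subst_stacks hd; have := size_subst_stacks hd'.
by move: (tot _) (tot _) => p q; nia.
Qed.

Definition isize (i : item) : nat :=
  match i with IVar n => n.+1 | ILam u => (lsize u).+1 | IApp => 1 end.

Lemma isize_items s : sumn (map isize (items s)) = lsize s.
Proof.
elim: s => [n|s IHs t IHt|s _] /=; rewrite ?addn0 // !map_cat !sumn_cat IHs IHt /=; lia.
Qed.

Lemma size_enc_items p : size (enc_items p) <= 2 * sumn (map isize p).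
Proof.
elim: p => [|i p IH] //; have -> : enc_items (i :: p) = enc_item i ++ enc_items p by [].
rewrite size_cat /=; case: i => [n|u|] /=; rewrite ?size_un; try lia.
by have := size_enc_le (tlam u) => /=; lia.
Qed.

(** The heap machine creates no new terms, so the size [N] of the input bounds all of them.
    Addresses never exceed the number of entries; a call adds both a task and an entry, so tasks
    exceed entries by at most one. *)
Definition hbound (N : nat) (b : hstate) : bool :=
  [&& all (fun x => (sumn (map isize x.1) <= N) && (x.2 <= size b.2)) b.1.1,
      all (fun g : aclos => (lsize g.1 <= N) && (g.2 <= size b.2)) b.1.2,
      all (fun e : aclos * nat => [&& lsize e.1.1 <= N, e.1.2 <= size b.2 & e.2 <= size b.2]) b.2
    & size b.1.1 <= (size b.2).+1].

Lemma alook_in h a n g (Q : aclos * nat -> bool) (R : aclos -> bool) :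
  (forall e, Q e -> R e.1) -> all Q h -> alook h a n = Some g -> R g.
Proof.
move=> hR hQ; have hget c e : aget h c = Some e -> Q e.
  by case/aget_split=> h1 [h2 [eh _]]; move: hQ; rewrite eh all_cat /= => /and3P[].
elim: n a => [|n IH] a /=; case e: (aget h a) => [[g' b]|] //=; last exact: IH.
by case=> <-; apply: (hR (g', b)); apply: hget e.
Qed.

Lemma hbound_step N b b' : hstep b b' -> hbound N b -> hbound N b'.
Proof.
case=> {b b'} /=.
- by move=> a T W h /and4P[/= /andP[_ hT] hW hh hs]; rewrite /hbound hT hW hh /=; lia.
- move=> u p a T W h /and4P[/= /andP[/andP[hp ha] hT] hW hh hs]; rewrite /hbound /= hT hW hh /=; lia.
- move=> n p a T W h g hl /and4P[/= /andP[/andP[hp ha] hT] hW hh hs].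
  have hg : (lsize g.1 <= N) && (g.2 <= size h).
    by apply: (alook_in (R := fun g => (lsize g.1 <= N) && (g.2 <= size h)) _ hh hl) => e /and3P[-> ->].
  by rewrite /hbound /= hT hW hh hg /=; lia.
move=> p a T [t ct] [s cs] W h /and4P[/= /andP[/andP[hp ha] hT] /and3P[/andP[ht hct] /andP[hs hcs] hW] hh hsz].
rewrite /hbound /= size_rcons all_rcons /= isize_items.
have lift (A : Type) (f : A -> nat) (Q : pred A) (r : seq A) :
    all (fun x => Q x && (f x <= size h)) r -> all (fun x => Q x && (f x <= (size h).+1)) r.
  by apply: sub_all => x /andP[-> /= hx]; exact: leqW.
rewrite (lift _ _ _ _ hT) (lift _ _ _ _ hW).
have -> : all (fun e : aclos * nat => [&& lsize e.1.1 <= N, e.1.2 <= (size h).+1 & e.2 <= (size h).+1]) h.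
  by apply: sub_all hh => e /and3P[-> h1 h2]; rewrite /= !leqW.
by rewrite /=; lia.
Qed.

Lemma size_flatten_map (A : Type) (f : A -> seq sym) (s : seq A) c :
  all (fun x => size (f x) <= c) s -> size (flatten (map f s)) <= size s * c.
Proof. by elim: s => [|x s IH] //= /andP[hx /IH h]; rewrite size_cat; nia. Qed.

Lemma hbound_tot N M b : hbound N b -> size b.2 <= M -> size b.1.2 <= M.+1 ->
  tot (heap_stacks b) <= M.+1 * (6 * N + 4 * M + 20).
Proof.
case: b => [[T W] h] /and4P[/= hT hW hh hs] hM hWM.
have h1 : size (enc_tasks T) <= size T * (2 * N + 1).
  apply: size_flatten_map; apply: sub_all hT => x /andP[hx _].
  by rewrite size_cat /=; have := size_enc_items x.1; lia.
have h2 : size (enc_addrs (map snd T)) <= size T * (M + 1).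
  rewrite -(size_map snd T); apply: size_flatten_map; rewrite all_map.
  by apply: sub_all hT => x /andP[_ hx]; rewrite /= size_cat size_un /=; lia.
have h3 : size (enc_vals (map fst W)) <= size W * (2 * N + 2).
  rewrite -(size_map fst W); apply: size_flatten_map; rewrite all_map.
  by apply: sub_all hW => x /andP[hx _]; rewrite /= size_rev; have := size_enc_le (tlam x.1) => /=; lia.
have h4 : size (enc_addrs (map snd W)) <= size W * (M + 1).
  rewrite -(size_map snd W); apply: size_flatten_map; rewrite all_map.
  by apply: sub_all hW => x /andP[_ hx]; rewrite /= size_cat size_un /=; lia.
have h5 : size (enc_aheap h) <= size h * (2 * N + 2 * M + 5).
  apply: size_flatten_map; apply: sub_all hh => -[[u c] b] /and3P[/= hu hc hb].
  by rewrite size_entry; have := size_enc_le (tlam u) => /=; lia.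
rewrite size_rev size_un.
have hTM : size T <= M.+1 by apply: leq_trans hs _.
have {}h1 := leq_trans h1 (leq_mul hTM (leqnn _)).
have {}h2 := leq_trans h2 (leq_mul hTM (leqnn _)).
have {}h3 := leq_trans h3 (leq_mul hWM (leqnn _)).
have {}h4 := leq_trans h4 (leq_mul hWM (leqnn _)).
have {}h5 := leq_trans h5 (leq_mul (leqW hM) (leqnn _)).
nia.
Qed.

Lemma alook_size h a n u c : alook h a n = Some (u, c) ->
  size (enc (tlam u)) + c <= size (enc_aheap h).
Proof.
have hget d e : aget h d = Some e -> size (enc (tlam e.1.1)) + e.1.2 <= size (enc_aheap h).
  case/aget_split=> h1 [h2 [-> _]]; rewrite enc_aheap_cat enc_aheap_cons !size_cat.
  by case: e => [[v d'] b]; rewrite size_entry /=; lia.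
elim: n a => [|n IH] a /=; case e: (aget h a) => [[g b]|] //=; last exact: IH.
by case=> eg; subst g; apply: hget e.
Qed.

(** Up to a constant, what a step adds is a copy of something already stored: a closure of the heap,
    the address of a task, or the heap length. *)
Lemma hstep_tot b b' : hstep b b' -> tot (heap_stacks b') <= 2 * tot (heap_stacks b) + 10.
Proof.
case=> {b b'}.
- move=> a T W h; rewrite /= /enc_tasks /enc_addrs /=.
  by do 3 rewrite ?(size_cat, size_rev, size_un) /=; lia.
- move=> u p a T W h; rewrite /= /enc_tasks /enc_items /enc_vals /enc_addrs /=.
  by do 3 rewrite ?(size_cat, size_rev, size_un) /=; lia.
- move=> n p a T W h [u c] /alook_size; rewrite /= /enc_tasks /enc_items /enc_vals /enc_addrs /=.
  by do 3 rewrite ?(size_cat, size_rev, size_un) /=; lia.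
move=> p a T [t ct] [s cs] W h.
rewrite /= size_rcons enc_aheap_rcons /enc_tasks /enc_vals /enc_addrs /= enc_items_term.
rewrite enc_lam; do 3 rewrite ?(size_cat, size_rev, size_un, size_entry) /=.
by rewrite !enc_lam /= !size_cat /=; lia.
Qed.

(** * The complete machine *)

Definition heap_bound N M := M.+1 * (6 * N + 4 * M + 20).
(** [2 * N] covers the initial state. Any later state arises from one smaller than the heap state,
    hence below [heap_bound], by a step that at most squares term size; the factor 2 is lost in
    encoding. *)
Definition subst_bound N M := 2 * N + 2 * (heap_bound N M * heap_bound N M).

(** A potential that each step of the substitution machine lowers by one: a push adds a value, a
    contraction lowers [n] by one and consumes two values. [sinv_len] keeps the subtraction from
    truncating. *)
Definition steps_left n (a : sstate) := 3 * n + 2 - size a.2.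

(* [ga] is the state of the substitution machine that the heap machine represents. *)
Definition global_inv (S N M : nat) (t : term) (m : nat) (a : sstate) (b : hstate) : Prop :=
  exists n1 n2 ga, [/\ sinv S t n1 a, sinv S t n2 ga /\ sim ga b,
    hbound N b && (size b.2 + n2 <= M),
    (tot (subst_stacks a) <= subst_bound N M) && (tot (heap_stacks b) <= 4 * S + 10)
    & m = steps_left n1 a + (steps_left n2 ga + size b.1.1 + n2)].

Lemma sinv_tot S t n a : sinv S t n a -> tot (subst_stacks a) <= 2 * S.
Proof.
case=> x [xs [hd _ _ /andP[hx _] _]].
by have := size_subst_stacks hd; lia.
Qed.

Lemma sinv_pos S t n a : sinv S t n a -> 0 < S.
Proof. by case=> x [xs [_ _ _ /andP[hx _] _]]; have := lsize_gt0 x; lia. Qed.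

Lemma Forall2_size (A B : Type) (R : A -> B -> Prop) s t : List.Forall2 R s t -> size s = size t.
Proof. by elim=> {s t} //= x y s t _ _ ->. Qed.

Lemma global_inv_heap S N M t m a b : global_inv S N M t m a b ->
  tot (heap_stacks b) <= heap_bound N M.
Proof.
case=> n1 [n2 [ga [_ [h2 [_ hW]] /andP[hb hM] _ _]]]; apply: hbound_tot => //; first lia.
by rewrite (Forall2_size hW); have := sinv_len h2; lia.
Qed.

Lemma global_inv_bounds S N M t m a b : global_inv S N M t m a b ->
  [/\ all (bound 1) a.2, weight a b <= subst_bound N M + heap_bound N M & weight a b <= 16 * S].
Proof.
move=> h; have hh := global_inv_heap h.
case: h => n1 [n2 [ga [h1 [h2 _] _ /andP[hs1 hs2] _]]].
split; last 1 first.
(* [2 * S + (4 * S + 10)] is at most [16 * S] because [S] is positive. *)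
- by have := sinv_tot h1; have := sinv_pos h1; rewrite /weight; lia.
- by case: h1 => x [xs [_ _ _ _ [_ /andP[]]]].
- by rewrite /weight; lia.
Qed.

Lemma hstep_sizes b b' : hstep b b' ->
  [\/ [/\ size b.1.1 = (size b'.1.1).+1, size b'.1.2 = size b.1.2 & size b'.2 = size b.2],
      [/\ size b'.1.1 = size b.1.1, size b'.1.2 = (size b.1.2).+1 & size b'.2 = size b.2]
    | [/\ size b'.1.1 = (size b.1.1).+1, size b.1.2 = (size b'.1.2).+2 & size b'.2 = (size b.2).+1]].
Proof.
case=> {b b'} *; [apply: Or31 | apply: Or32 | apply: Or32 | apply: Or33] => //.
by split; rewrite //= size_rcons.
Qed.

(** If the heap machine moves, its size was at most that of the substitution state, at most [2 * S],
    and doubling yields [4 * S + 10]. In the measure, [HRet] is paid for by the number of tasks, and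
    the task added by a call by the decrease of [n2]. *)
Lemma global_inv_step S N M t m a b : global_inv S N M t m a b -> running a b ->
  exists m' a' b', [/\ m' < m, global_inv S N M t m' a' b' & advance a a' b b'].
Proof.
move=> hI /andP[ra rb]; have hh := global_inv_heap hI.
case: hI => n1 [n2 [ga [h1 [h2 hsim] /andP[hb hM] /andP[hs1 hs2] em]]].
have l1 := sinv_len h1; have l2 := sinv_len h2; have S0 := sinv_pos h1.
have z1 := sinv_tot h1.
rewrite /advance; case: leqP => hle.
  have [b' hs hcase] := sim_step h2 hsim rb.
  have hb' := hbound_step hs hb; have htot := hstep_tot hs.
  have htot' : tot (heap_stacks b') <= 4 * S + 10 by lia.
  case: hcase => [[hsim' [e1 e2]]|[ga' hg hsim']].
    exists m.-1, a, b'; split=> //; first by rewrite em e1; lia.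
    by exists n1, n2, ga; split=> //; rewrite ?e2 ?hb' ?hM ?hs1 // em e1; lia.
  have [n' h2' hn] := sinv_step h2 hg.
  have l2' := sinv_len h2'.
  (* The simulation keeps both value stacks equally long, so their lengths identify the heap rule
     used: a task and an entry are added exactly when a redex is contracted. *)
  have [eT eh] : size b'.1.1 = size b.1.1 + (n2 - n') /\ size b'.2 = size b.2 + (n2 - n').
    case: (hsim) (hsim') => _ /Forall2_size eW [_ /Forall2_size eW'].
    by case: (hstep_sizes hs) => -[eT' eWW eh']; lia.
  exists m.-1, a, b'; split=> //; first by rewrite em /steps_left; lia.
  exists n1, n', ga'; split=> //; rewrite ?hb' ?hs1 //; first lia.
  rewrite em /steps_left; lia.
have [a' hs] := sinv_prog h1 ra.
have [n' h1' hn] := sinv_step h1 hs; have l1' := sinv_len h1'.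
exists m.-1, a', b; split=> //; first by rewrite em /steps_left; lia.
exists n', n2, ga; split=> //; rewrite ?hb ?hM ?hs2 ?andbT //.
  apply: leq_trans (size_sstep h1 hs) _; rewrite /subst_bound.
  have hz : tot (subst_stacks a) <= heap_bound N M by lia.
  by have := leq_mul hz hz; lia.
by rewrite em /steps_left; lia.
Qed.

(** * Polynomial bounds and the final assembly *)

Definition poly (f : nat -> nat) := exists c k, forall y, f y <= c * y.+1 ^ k.

Lemma poly_const c : poly (fun=> c).
Proof. by exists c, 0 => y; rewrite expn0 muln1. Qed.

Lemma poly_id : poly id.
Proof. by exists 1, 1 => y; rewrite expn1 mul1n. Qed.

Lemma poly_add f g : poly f -> poly g -> poly (fun y => f y + g y).
Proof.
move=> [c [k hf]] [d [l hg]]; exists (c + d), (k + l) => y; rewrite mulnDl.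
apply: leq_add; [apply: leq_trans (hf y) _ | apply: leq_trans (hg y) _];
  by rewrite leq_mul // leq_pexp2l // ?leq_addr ?leq_addl.
Qed.

Lemma poly_mul f g : poly f -> poly g -> poly (fun y => f y * g y).
Proof.
move=> [c [k hf]] [d [l hg]]; exists (c * d), (k + l) => y.
by rewrite expnD mulnACA leq_mul.
Qed.

Definition total_bound y := subst_bound y y + heap_bound y y.
(** The summands are loading, at most [7 * y + 6] iterations of the main loop, and output. The cost
    of a round depends on the sum of the weights before and after it, hence [2 * total_bound y]. *)
Definition run_time y :=
  (14 * y + 10) + ((7 * y + 6) * (round_time (2 * total_bound y)).+1 +
    20 * (1000 * total_bound y + 1000) * (1000 * total_bound y + 1000)).

Lemma poly_succ f : poly f -> poly (fun y => (f y).+1).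
Proof.
move=> hf; have [c [k h]] := poly_add hf (poly_const 1).
by exists c, k => y; rewrite -addn1.
Qed.

Ltac poly_tac := lazymatch goal with
  | |- poly (fun y => y) => exact poly_id
  | |- poly (fun _ => ?c) => exact (poly_const c)
  | |- poly (fun y => addn (@?f y) (@?g y)) => apply (@poly_add f g); poly_tac
  | |- poly (fun y => muln (@?f y) (@?g y)) => apply (@poly_mul f g); poly_tac
  | |- poly (fun y => S (@?f y)) => apply (@poly_succ f); poly_tac
  end.

Lemma poly_run_time : poly (fun y => 3 * run_time y + 2 * y + 3).
Proof.
rewrite /run_time /round_time /total_bound /subst_bound /heap_bound.
poly_tac.
Qed.

(** With no program left, a state represents its only value, which is [t] since an abstraction does
    not reduce. If the heap machine has halted, this applies to the ghost state, and the simulation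
    gives the unfolding. *)
Lemma global_inv_final S N M t m a b : global_inv S N M t m a b -> ~~ running a b ->
  exists h g, final a b h g /\ closure_rep (hheap h) (hclos g) t.
Proof.
case: a b => P V [[T W] h]; case=> n1 [n2 [ga [h1 [h2 hsim] _ _ _]]].
rewrite /running negb_and !negbK /final /= => hr; case eP: (nilp P).
  case: P eP h1 {hr} => // _ [x [xs [/= hd hc [ht ha] _ [_ /andP[hb _]]]]].
  case: V hd hb => [|u [|v V]] //= [ex] /andP[hu _]; subst x.
  have et : t = tlam u.
    by case: xs hc ht {ha} => [|y xs] /= => [_ <-//|[/step_abs []]].
  exists [::], (u, 0); split=> //; exists (tlam u); split; first by exists u.
  by rewrite et; apply: unfolds_closed.
move: hr; rewrite eP /= => eT; case: T eT hsim => // _ [/= hP hW].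
case: ga h2 hP hW => P' V' [x [xs [/= hd hc [ht ha] _ _]]] hP hW.
inversion hP; subst P'; case: V' hd hW => [|v [|w V']] //= [ex] hW; subst x.
have et : t = tlam v.
  by case: xs hc ht {ha} => [|y xs] /= => [_ <-//|[/step_abs []]].
inversion hW as [|[u c] ? W' ? hg hW']; subst; inversion hW'; subst.
exists h, (u, c); split=> //; exists (tlam u); split; first by exists u.
by rewrite et; exact: hg.
Qed.

Lemma global_inv_start s xs t : closedL s -> evaluates s xs t ->
  exists2 m, m <= 7 * Time xs + 5 &
    global_inv (Space s xs) (lsize s) (Time xs) t m (start_s s) (start_h s).
Proof.
move=> hs [hc [ht ha]].
have hS : all (fun y => lsize y <= Space s xs) (s :: xs).
  rewrite /Space; elim: (s :: xs) => [|y r IH] //=; rewrite big_cons leq_maxl /=.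
  by apply: sub_all IH => z hz; apply: leq_trans hz (leq_maxr _ _).
have hdec : dec [::] (flat s) = [:: s] by rewrite -[flat s]cats0 dec_flat.
have hinv : sinv (Space s xs) t (Time xs) (start_s s).
  by exists s, xs; split=> //; split=> //=; apply: flat_closed.
have hsim : sim (start_s s) (start_h s).
  split; last by constructor.
  rewrite /= /flat_tasks /= cats0; apply: items_sim; exact: unfolds_closed.
(* With [n = Time xs] this is [2 * (3 * n + 2) + 1 + n], the 1 being the initial task. *)
exists (steps_left (Time xs) (start_s s) + (steps_left (Time xs) (start_s s) + 1 + Time xs)).
  by rewrite /steps_left /=; lia.
have hN : lsize s <= Space s xs by case/andP: hS.
exists (Time xs), (Time xs), (start_s s); split=> //.
- by rewrite /hbound /= isize_items; lia.
- have := size_subst_stacks (a := start_s s) hdec; rewrite /subst_bound => h1.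
  apply/andP; split; first lia.
  have -> : heap_stacks (start_h s) =
      [:: enc s ++ [:: sRet]; [:: sSep]; [::]; [::]; [::]; [::]; [::]; [::]; [::]; [::]].
    by rewrite /heap_stacks /enc_tasks /= enc_items_term cats0.
  by rewrite /= size_cat /=; have := size_enc_le s; have := lsize_gt0 s; lia.
Qed.

Definition machine := load ;; main_loop ;; finish.

Lemma subst_bound_mono N M y : N <= y -> M <= y -> subst_bound N M + heap_bound N M <= total_bound y.
Proof.
move=> hN hM; have h : heap_bound N M <= heap_bound y y by apply: leq_mul; lia.
by rewrite /total_bound /subst_bound; have := leq_mul h h; lia.
Qed.

Lemma runs_machine s xs t : closedL s -> evaluates s xs t ->
  exists S H g, [/\ closure_rep H g t, get S 0 = rev (enc_output H g) &
    runs machine (rev (enc s) :: nseq 15 [::]) S (run_time (lsize s + Time xs))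
      (1000 * (20 * Space s xs))].
Proof.
move=> hs he; have [m hm hI] := global_inv_start hs he.
set Sp := Space s xs in hI *; set M := Time xs in hm hI *; set y := lsize s + M.
have [m' [a' [b' [hI' hr hrun]]]] := runs_main_loop (@global_inv_bounds Sp (lsize s) M t)
  (@global_inv_step Sp (lsize s) M t) hI.
have [h [[u c] [hf hrep]]] := global_inv_final hI' hr.
have [_ hw hw'] := global_inv_bounds hI'.
(* The bound stays expressed by the weight of the final state, so that its time can use the
   polynomial estimate and its space the linear one. *)
have [S hS hfin] := runs_finish hf (leqnn _).
have hy : subst_bound (lsize s) M + heap_bound (lsize s) M <= total_bound y.
  by apply: subst_bound_mono; rewrite /y; lia.
have [S0 hN] : 0 < Sp /\ lsize s <= Sp.
  case: (hI) => n1 [n2 [ga [h1 _ _ _ _]]]; split; first exact: sinv_pos h1.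
  by rewrite /Sp /Space big_cons leq_maxl.
have henc := size_enc_le s.
exists S, (hheap h), (hclos (u, c)); split=> //.
apply: runs_weak.
- apply: (@runs_seq _ _ _ _ _ _ _ (1000 * (20 * Sp))).
    apply: runT_runs (runT_load hs) (leqnn _) _.
    have -> : tot (rev (enc s) :: nseq 15 [::]) = size (enc s) by rewrite /= size_rev; lia.
    lia.
  apply: runs_seq; first by apply: runs_weak hrun (leqnn _) _; lia.
  by apply: runs_weak hfin (leqnn _) _; lia.
- rewrite /run_time -/y; apply: leq_add; first by rewrite /y; lia.
  apply: leq_add.
    apply: leq_mul; first by rewrite /y; lia.
    by rewrite ltnS; apply: round_time_mono; lia.
  by apply: leq_mul; [apply: leq_mul | ]; lia.
- by [].
Qed.

Theorem theorem20 :
  exists (Sig : finType) (e : sym -> Sig), injective e /\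
  exists (n : nat) (M : TM Sig n.+1) (c k : nat),
    forall (s : term) (xs : seq term) (t : term),
      closedL s -> evaluates s xs t ->
      let c0 := tm_init M (map e (enc_prog (gamma s))) in
      exists steps : nat,
        steps <= c * (lsize s + Time xs + 1) ^ k /\
        tm_halted (tm_run steps c0) /\
        (forall i, i <= steps -> tm_space (tm_run i c0) <= c * Space s xs) /\
        exists (H : heap) (g : hclosure),
          closure_rep H g t /\ tape_holds ((tm_run steps c0).2 ord0) (map e (enc_output H g)).
Proof.
have [c [k hp]] := poly_run_time.
(* Index 15 means sixteen tapes, each of length at most [1000 * (20 * Space s xs) + 2]; adding this
   to [c] lets one constant serve both bounds. *)
exists sym, id; split=> //; exists 15, (compile 15 machine), (c + 16 * (1000 * 20 + 2)), k.
move=> s xs t hs he; rewrite map_id.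
have -> : enc_prog (gamma s) = enc s by rewrite enc.unlock.
have [S [H [g [hrep hS hrun]]]] := runs_machine hs he.
have hne : enc s != [::] by have := size_enc_le s; have := lsize_gt0 s; case: (enc s) => //=; lia.
have [steps [h1 h2 h3 h4]] := compile_ok hne hrun.
exists steps; split; last split=> //; last split.
- rewrite addn1 mulnDl; have := hp (lsize s + Time xs); cbv beta.
  move: (run_time _) (_.+1 ^ k) h1 => p q h1 hq; have he' := size_enc_le s.
  apply: leq_trans h1 (leq_trans (leq_trans _ hq) (leq_addr _ _)).
  rewrite leq_add2r leq_add2l; case/andP: he' => _ h; apply: leq_trans h _.
  by rewrite leq_mul2l leq_addr.
- move=> i hi; apply: leq_trans (h3 i hi) _.
  have S0 : 0 < Space s xs by rewrite /Space big_cons; have := lsize_gt0 s; lia.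
  by rewrite mulnDl; apply: leq_trans (leq_addl _ _); lia.
- by exists H, g; split=> //; rewrite map_id; move: h4; rewrite hS revK.
Qed.
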